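(* Let $S^{(1)},S^{(2)}\in\operatorname{Sp}(2n,\mathbb{R})$ with block forms $S^{(p)}=\begin{pmatrix}A^{(p)}&B^{(p)}\\ C^{(p)}&D^{(p)}\end{pmatrix}$, $p=1,2$, and put $$D^{(1,2)}=\begin{pmatrix}A^{(1)}&B^{(1)}\\ A^{(2)}&B^{(2)}\end{pmatrix},\qquad \Omega=D^{(1,2)}J\,(D^{(1,2)})^T .$$ Let $f\in L^2(\mathbb{R}^n)$ satisfy $\|f\|_2=1$, $\int_{\mathbb{R}^{2n}}(1+|z|^2)\,|W_\sigma f(z)|\,dz<\infty$, and $\int_{\mathbb{R}^{2n}}z_\alpha W_\sigma f(z)\,dz=0$ for $\alpha=1,\dots,2n$. Let $\Sigma$ be the covariance matrix with entries $\Sigma_{\alpha\beta}=\int_{\mathbb{R}^{2n}}z_\alpha z_\beta W_\sigma f(z)\,dz$, and let $\Upsilon=D^{(1,2)}\Sigma\,(D^{(1,2)})^T$. Then the matrix inequality $$\Upsilon+\frac{i}{4\pi}\,\Omega\;\ge\;0$$ holds, i.e. this Hermitian matrix is positive semidefinite.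
   Context: $J=\begin{pmatrix}0&I_n\\ -I_n&0\end{pmatrix}$, and $\operatorname{Sp}(2n,\mathbb{R})$ is the group of real $2n\times2n$ matrices $S$ with $S^TJS=J$. Points of $\mathbb{R}^{2n}$ are written $z=(x,\xi)$, $x,\xi\in\mathbb{R}^n$. The Wigner function of $f\in L^2(\mathbb{R}^n)$ is $$W_\sigma f(x,\xi)=\int_{\mathbb{R}^n}f\left(x+\tfrac y2\right)\overline{f\left(x-\tfrac y2\right)}\,e^{-2i\pi\xi\cdot y}\,dy .$$ $\Upsilon$ is the covariance matrix of the joint variable $\gamma=(\xi^{(1)},\xi^{(2)})=D^{(1,2)}z$, i.e. $\Upsilon_{\alpha\beta}=\int\gamma_\alpha\gamma_\beta W_\sigma f(z)\,dz$ with $\gamma=D^{(1,2)}z$. *)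

(* Defs.v *)
From HB Require Import structures.
From mathcomp Require Import all_boot all_order all_algebra.
From mathcomp Require Import all_classical all_reals all_analysis.
From mathcomp Require Import complex.

Set Implicit Arguments.
Unset Strict Implicit.
Unset Printing Implicit Defensive.

Import Order.TTheory GRing.Theory Num.Theory.
Import numFieldNormedType.Exports.

Local Open Scope classical_set_scope.
Local Open Scope ring_scope.
Local Open Scope complex_scope.
Local Open Scope sesquilinear_scope.

Definition measure_matrix_display : measure_display -> measure_display.
Proof. exact. Qed.

Section measurable_matrix.
Context {d} {T : measurableType d} (m n : nat).

Definition measurable_matrix_generators : set (set 'M[T]_(m, n)) :=
  \bigcup_ij preimage_set_system setT (fun A : 'M[T]_(m, n) => A ij.1 ij.2)
    measurable.

(* The product sigma-algebra; for [T := R] it is the Borel sigma-algebra. *)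
HB.instance Definition _ := @isMeasurable.Build (measure_matrix_display d)
  'M[T]_(m, n) <<s measurable_matrix_generators >>
  (@sigma_algebra0 _ setT _) (@sigma_algebraC _ _)
  (@sigma_algebra_bigcup _ setT _).

Lemma measurable_entry (i : 'I_m) (j : 'I_n) :
  measurable_fun setT (fun A : 'M[T]_(m, n) => A i j).
Proof.
move=> _ Y mY; apply: sub_sigma_algebra; exists (i, j) => //=.
by exists Y.
Qed.

Lemma measurable_fun_matrixP d' (S : measurableType d')
    (f : S -> 'M[T]_(m, n)) :
  (forall i j, measurable_fun setT (fun s => f s i j)) -> measurable_fun setT f.
Proof.
move=> mf; apply: (measurability measurable_matrix_generators) => //.
move=> _ [_ [[i j] _ [Y mY <-]] <-] /=; rewrite setTI setTI.
by have := mf i j measurableT Y mY; rewrite setTI.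
Qed.

End measurable_matrix.

Section lebesgue_measure_cV.
Context {R : realType}.

Definition cons_cV n (p : R * 'cV[R]_n) : 'cV[R]_n.+1 :=
  col_mx (p.1)%:M p.2.

Definition uncons_cV n (z : 'cV[R]_n.+1) : R * 'cV[R]_n :=
  (z ord0 ord0, \col_i z (lift ord0 i) ord0).

Lemma cons_cV0 n (p : R * 'cV[R]_n) : cons_cV p ord0 ord0 = p.1.
Proof.
have -> : ord0 = lshift n ord0 :> 'I_(1 + n) by exact: val_inj.
by rewrite [LHS](@col_mxEu _ 1 n) mxE.
Qed.

Lemma cons_cVS n (p : R * 'cV[R]_n) i : cons_cV p (lift ord0 i) ord0 = p.2 i ord0.
Proof.
have -> : lift ord0 i = rshift 1 i :> 'I_(1 + n) by exact: val_inj.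
by rewrite [LHS](@col_mxEd _ 1 n).
Qed.

Lemma cons_cVK n : cancel (@cons_cV n) (@uncons_cV n).
Proof.
move=> p; rewrite /uncons_cV cons_cV0 [RHS]surjective_pairing; congr pair.
by apply/colP => i; rewrite mxE cons_cVS.
Qed.

Lemma measurable_cons_cV n : measurable_fun setT (@cons_cV n).
Proof.
apply: measurable_fun_matrixP => i j; rewrite (ord1 j).
case: (unliftP ord0 i) => [k ->|->].
  rewrite (_ : (fun _ => _) = (fun y : 'cV[R]_n => y k ord0) \o snd).
    by apply: measurableT_comp => //; exact: measurable_entry.
  by apply/funext => p; rewrite /= cons_cVS.
rewrite (_ : (fun _ => _) = fst) //.
by apply/funext => p; rewrite cons_cV0.
Qed.

Lemma measurable_uncons_cV n : measurable_fun setT (@uncons_cV n).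
Proof.
apply/measurable_fun_pairP; split; first exact: measurable_entry.
apply: measurable_fun_matrixP => i j.
rewrite (_ : (fun _ => _) = (fun z : 'cV[R]_n.+1 => z (lift ord0 i) ord0)).
  exact: measurable_entry.
by apply/funext => z; rewrite /= mxE.
Qed.

Section lebesgue_cons.
Variables (n : nat) (mu : {sigma_finite_measure set 'cV[R]_n -> \bar R}).
Local Open Scope ereal_scope.

Definition lebesgue_cons : set 'cV[R]_n.+1 -> \bar R :=
  pushforward (lebesgue_measure \x mu) (@cons_cV n).

(* Needed in the context by the instance for [pushforward]. *)
Let mcons := @measurable_cons_cV n.

Let lebesgue_cons0 : lebesgue_cons set0 = 0.
Proof. exact: measure0. Qed.

Let lebesgue_cons_ge0 A : 0 <= lebesgue_cons A.
Proof. exact: measure_ge0. Qed.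

Let lebesgue_cons_sigma_additive : semi_sigma_additive lebesgue_cons.
Proof. exact: measure_semi_sigma_additive. Qed.

HB.instance Definition _ := isMeasure.Build _ _ _ lebesgue_cons
  lebesgue_cons0 lebesgue_cons_ge0 lebesgue_cons_sigma_additive.

Let lebesgue_cons_sigma_finite : sigma_finite setT lebesgue_cons.
Proof.
have /sigma_finiteP[F [TF ndF Foo]] := sigma_finiteT (@lebesgue_measure R).
have /sigma_finiteP[G [TG ndG Goo]] := sigma_finiteT mu.
exists (fun k => @uncons_cV n @^-1` (F k `*` G k)).
  rewrite predeqE => z; split => // _.
  have [i _ Fi] : (\bigcup_i F i) (uncons_cV z).1 by rewrite -TF.
  have [j _ Gj] : (\bigcup_i G i) (uncons_cV z).2 by rewrite -TG.
  exists (maxn i j) => //; split.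
    by move: Fi; apply/subsetPset/ndF/leq_maxl.
  by move: Gj; apply/subsetPset/ndG/leq_maxr.
move=> k; have [mF Fk] := Foo k; have [mG Gk] := Goo k.
have mFG : measurable (F k `*` G k) by exact: measurableX.
split; first by rewrite -[X in measurable X]setTI; exact: measurable_uncons_cV.
rewrite /lebesgue_cons /pushforward -comp_preimage.
rewrite (_ : _ @^-1` _ = F k `*` G k).
  by rewrite product_measure1E// lte_mul_pinfty// ge0_fin_numE.
rewrite (_ : _ \o _ = id)//; apply/funext => p; exact: cons_cVK.
Qed.

HB.instance Definition _ := Measure_isSigmaFinite.Build _ _ _ lebesgue_cons
  lebesgue_cons_sigma_finite.

End lebesgue_cons.

(* Lebesgue measure on [R^n = 'cV[R]_n], by recursion on the dimension: the
   image of the product of the one-dimensional measure with the previous one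
   under [R * R^n ~ R^n.+1]; a unit mass for [n = 0]. *)
Fixpoint lebesgue_cV n : {sigma_finite_measure set 'cV[R]_n -> \bar R} :=
  if n is n'.+1 then lebesgue_cons (lebesgue_cV n') else \d_(0 : 'cV[R]_0).

End lebesgue_measure_cV.

(* As for [Rintegral], the value is meaningful only when both components are
   integrable. *)
Definition Cintegral d (T : measurableType d) (R : realType)
    (mu : {measure set T -> \bar R}) (F : T -> R[i]) : R[i] :=
  (\int[mu]_t complex.Re (F t)) +i* (\int[mu]_t complex.Im (F t)).

Definition expi (R : realType) (theta : R) : R[i] := cos theta +i* sin theta.

Definition L2norm (R : realType) (n : nat) (f : 'cV[R]_n -> R[i]) : \bar R :=
  Lnorm (lebesgue_cV n) 2%:E (fun x => (Normc.normc (f x))%:E).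

(* [f] is a Borel representative of its class in [L^2(R^n)]. *)
Definition L2 (R : realType) (n : nat) (f : 'cV[R]_n -> R[i]) : Prop :=
  [/\ measurable_fun setT (fun x => complex.Re (f x)),
      measurable_fun setT (fun x => complex.Im (f x)) &
      (L2norm f < +oo)%E].

Section phase_space.
Context {R : realType} {n : nat}.

Definition dotv (x y : 'cV[R]_n) : R := \sum_i x i ord0 * y i ord0.

Definition wigner (f : 'cV[R]_n -> R[i]) (x xi : 'cV[R]_n) : R[i] :=
  Cintegral (lebesgue_cV n) (fun y =>
    f (x + 2^-1 *: y) * (f (x - 2^-1 *: y))^*
      * expi (- (2 * pi * dotv xi y))).

(* A point of phase space is the column [z = col_mx x xi]. *)
Definition Wigner (f : 'cV[R]_n -> R[i]) (z : 'cV[R]_(n + n)) : R[i] :=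
  wigner f (usubmx z) (dsubmx z).

(* [Wigner f] is real-valued, but it is defined by a complex integral, whence
   the complex entries. *)
Definition wigner_cov (f : 'cV[R]_n -> R[i]) : 'M[R[i]]_(n + n) :=
  \matrix_(a, b) Cintegral (lebesgue_cV (n + n))
           (fun z => (z a ord0 * z b ord0)%:C * Wigner f z).

Definition symplJ : 'M[R]_(n + n) := block_mx 0 1%:M (- 1%:M) 0.

Definition symplectic (S : 'M[R]_(n + n)) : Prop :=
  S^T *m symplJ *m S = symplJ.

End phase_space.

(* [^t*] is the conjugate transpose; in [R[i]], [0 <= c] entails that [c] is
   real. *)
Definition psdmx (C : numClosedFieldType) (m : nat) (M : 'M[C]_m) : Prop :=
  M \is hermsymmx /\
  forall v : 'cV[C]_m, 0 <= (v ^t* *m M *m v) ord0 ord0.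

(* Main.v *)
Require Import Defs.
From mathcomp Require Import all_boot all_order all_algebra.
From mathcomp Require Import all_classical all_reals all_analysis.
From mathcomp Require Import measurable_realfun complex ring lra.

Set Implicit Arguments.
Unset Strict Implicit.
Unset Printing Implicit Defensive.

Import Order.TTheory GRing.Theory Num.Theory.
Import numFieldNormedType.Exports.

Local Open Scope classical_set_scope.
Local Open Scope ring_scope.
Local Open Scope complex_scope.

(** Since [Omega] is [D12 *m symplJ *m D12^T], the Hermitian matrix of the
theorem is the congruence transform by the real matrix [D12] of
[Sigma + (i / 4 pi) J], and congruence preserves positive semidefiniteness
([psdmx_congr]). It remains to prove the Robertson-Schrodinger inequality
[Sigma + (i / 4 pi) J >= 0] on phase space ([robertson_schrodinger]). For a
complex vector [p + i q] it says that
[4 pi^2 \int W(z) ((z.p)^2 + (z.q)^2) dz + 2 pi sigma(p, q)] is nonnegative,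
with [sigma] the symplectic form ([uncertainty_ge0]).

The textbook proof writes this number as the squared norm of a combination of
the position and momentum operators applied to [f], which requires [f] to lie
in their domains. Here finite differences replace the operators. For phase-space
points [p_j] and complex numbers [c_j], the superposition of Weyl translates
[\sum_j c_j (weyl p_j)] has a nonnegative squared norm; its expansion involves
the values of [corr], the two-sided Fourier transform of the Wigner function, at
the differences [p_j - p_k]. Hence the integral of [W] against a twisted sum of
characters is nonnegative ([quantum_bochner]). With the points [0], [t p], [t q]
and the coefficients [-(1 + i)], [1], [i], which sum to zero, this integral is of
order [t^2], and after division by [t^2] its limit at [t = 0] is the number
above. The limit passes under the integral by dominated convergence, the second
moment of [|W|] being finite ([theta_le], [cvg_theta]).

The analytic content is therefore Fourier inversion for [W]
([wigner_inversion]): [\int W(x, xi) e(x.b + xi.a) dx dxi = corr f b a]. Fubini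
does not apply directly, because the integrand before integration in [y] is not
absolutely integrable. Damping the frequencies by [exp(- e |xi|)] makes it
applicable, and turns the right-hand side into an average of [corr] around [a]
with Lorentz weights of width [e] ([wigner_regularized]). Both sides converge as
[e] tends to [0]: the left one because [W] is integrable, the right one because
[corr] is bounded and continuous, which is the continuity of translations in
[L^2] ([L2_translation]). *)

(** * Affine changes of variables for Lebesgue measure *)

Section transport.
Context d1 d2 (T1 : measurableType d1) (T2 : measurableType d2) (R : realType).
Implicit Types (mu : {measure set T1 -> \bar R}) (nu : {measure set T2 -> \bar R}).

(** The change-of-variables formula is taken as the definition, rather than an
identity of measures, because Tonelli then propagates it along the recursion on
the dimension. *)
Definition transport mu nu (phi : T1 -> T2) (k : R) : Prop :=
  [/\ measurable_fun setT phi, 0 <= k &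
   forall g : T2 -> \bar R, measurable_fun setT g -> (forall y, 0 <= g y)%E ->
     (\int[mu]_x g (phi x) = k%:E * \int[nu]_y g y)%E].

Lemma transport_measure mu nu (phi : T1 -> T2) (k : R) :
  measurable_fun setT phi -> 0 <= k ->
  (forall A, measurable A -> mu (phi @^-1` A) = k%:E * nu A)%E ->
  transport mu nu phi k.
Proof.
move=> mphi k0 H; split => // g mg g0.
have -> : (\int[mu]_x g (phi x) = \int[pushforward mu phi]_y g y)%E.
  by rewrite ge0_integral_pushforward// preimage_setT.
rewrite -[k]/(NngNum k0)%:num -ge0_integral_mscale//.
by apply: eq_measure_integral => A mA _; exact: H.
Qed.

Lemma transport_integrable mu nu phi k (f : T2 -> \bar R) :
  transport mu nu phi k ->
  nu.-integrable setT f -> mu.-integrable setT (f \o phi).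
Proof.
move=> [mphi k0 H] /integrableP[mf foo]; apply/integrableP; split.
  exact: measurableT_comp.
rewrite (H (fun y => `|f y|)%E)//; first by rewrite lte_mul_pinfty.
exact: measurableT_comp.
Qed.

Lemma transport_Rintegral mu nu phi k (f : T2 -> R) :
  transport mu nu phi k -> nu.-integrable setT (EFin \o f) ->
  \int[mu]_x f (phi x) = k * \int[nu]_y f y.
Proof.
move=> [mphi k0 H] intf; have [mf foo] := integrableP _ _ _ intf.
rewrite /Rintegral integralE [in RHS]integralE.
have Hp : (\int[mu]_x (fun x => (f (phi x))%:E)^\+ x =
    k%:E * \int[nu]_x (fun x => (f x)%:E)^\+ x)%E.
  have := H (EFin \o f)^\+%E (measurable_funepos mf) (funepos_ge0 _).
  by move=> <-; apply: eq_integral => ? _; rewrite ?funeposE ?funenegE.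
have Hn : (\int[mu]_x (fun x => (f (phi x))%:E)^\- x =
    k%:E * \int[nu]_x (fun x => (f x)%:E)^\- x)%E.
  have := H (EFin \o f)^\-%E (measurable_funeneg mf) (funeneg_ge0 _).
  by move=> <-; apply: eq_integral => ? _; rewrite ?funeposE ?funenegE.
rewrite Hp Hn.
have /(integrable_fin_num measurableT) ip := integrable_funepos measurableT intf.
have /(integrable_fin_num measurableT) im := integrable_funeneg measurableT intf.
rewrite -[k in RHS]/(fine k%:E) -fineM//; last by rewrite fin_numB ip im.
by rewrite [in RHS]muleBr ?fin_num_adde_defr.
Qed.

End transport.

Section lebesgue_affine.
Context {R : realType}.
Local Notation mu := (@lebesgue_measure R).

Lemma measurable_affine (a c : R) : measurable_fun setT (fun x : R => a + c * x).
Proof. by apply: measurable_funD => //; exact: measurable_funM. Qed.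

Lemma affine_preimage_itv (a c x y : R) : c != 0 ->
  mu ((fun t : R => a + c * t) @^-1` `]x, y]) = (`|c|^-1%:E * mu `]x, y])%E.
Proof.
move=> c0; case: (ltgtP c 0) c0 => // c0 _.
- have -> : (fun t : R => a + c * t) @^-1` `]x, y] = `[(y - a) / c, (x - a) / c[%classic.
    apply/seteqP; split => t /=; rewrite !in_itv/= ler_ndivrMr// ltr_ndivlMr// lerBrDl ltrBlDl.
      by rewrite (mulrC t) => /andP[-> ->].
    by rewrite (mulrC t) => /andP[-> ->].
  rewrite !lebesgue_measure_itv/= !lte_fin ltr_ndivrMr// divfK ?lt_eqF// ltrD2r.
  case: ifPn => _; last by rewrite mule0.
  rewrite -!EFinD -EFinM; congr EFin.
  by rewrite ltr0_norm//; field; rewrite lt_eqF.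
- have -> : (fun t : R => a + c * t) @^-1` `]x, y] = `](x - a) / c, (y - a) / c]%classic.
    apply/seteqP; split => t /=; rewrite !in_itv/= ler_pdivlMr// ltr_pdivrMr// lerBrDl ltrBlDl.
      by rewrite (mulrC t) => /andP[-> ->].
    by rewrite (mulrC t) => /andP[-> ->].
  rewrite !lebesgue_measure_itv/= !lte_fin ltr_pdivrMr// divfK ?gt_eqF// ltrD2r.
  case: ifPn => _; last by rewrite mule0.
  rewrite -!EFinD -EFinM; congr EFin.
  by rewrite gtr0_norm//; field; rewrite gt_eqF.
Qed.

(** Lebesgue measure is characterized by its values on half-open intervals. *)
Lemma transport_lebesgue_affine (a c : R) : c != 0 ->
  transport mu mu (fun x => a + c * x) `|c|^-1.
Proof.
move=> c0; pose phi (x : measurableTypeR R) : measurableTypeR R := a + c * x.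
have mphi : measurable_fun setT phi := measurable_affine a c.
apply: transport_measure => // A mA.
have k0 : 0 <= `|c| by [].
pose m' : {measure set (measurableTypeR R) -> \bar R} :=
  mscale (NngNum k0) (pushforward mu phi).
have muE : mu A = m' mphi A.
  apply: (lebesgue_measure_unique (mu := m' mphi)) => //= _ [[x y]] _ <-.
  rewrite /m' /mscale/= /pushforward affine_preimage_itv// muleA -EFinM.
  by rewrite divff ?normr_eq0// mul1e.
transitivity (`|c|^-1%:E * m' mphi A)%E; last by congr (_ * _)%E; exact/esym.
by rewrite /m'/= /mscale/= /pushforward muleA -EFinM mulVf ?mul1e// normr_eq0.
Qed.

End lebesgue_affine.

Section lebesgue_cV_transport.
Context {R : realType}.

Lemma transport_cons n : transport (lebesgue_measure \x lebesgue_cV n)%E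
  (lebesgue_cV n.+1) (@cons_cV R n) 1.
Proof.
have mc := @measurable_cons_cV R n.
apply: transport_measure => // A mA.
by rewrite mul1e.
Qed.

Lemma ge0_integral_cons n (g : 'cV[R]_n.+1 -> \bar R) :
  measurable_fun setT g -> (forall x, 0 <= g x)%E ->
  (\int[lebesgue_cV n.+1]_x g x =
   \int[lebesgue_measure]_t \int[lebesgue_cV n]_x g (cons_cV (t, x)))%E.
Proof.
move=> mg g0; have [_ _ /(_ g mg g0)] := transport_cons n.
rewrite mul1e => <-.
apply: (fubini_tonelli1 (m1 := @lebesgue_measure R) (m2 := lebesgue_cV n)
  (fun p => g (cons_cV p))) => //.
by apply: measurableT_comp => //; exact: measurable_cons_cV.
Qed.

Lemma measurable_affine_cV n (a : 'cV[R]_n) (c : R) :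
  measurable_fun setT (fun x : 'cV[R]_n => a + c *: x).
Proof.
apply: measurable_fun_matrixP => i j.
rewrite (_ : (fun _ => _) = (fun x : 'cV[R]_n => a i j + c * x i j)).
  apply: measurable_funD => //; apply: measurable_funM => //.
  exact: measurable_entry.
by apply/funext => x; rewrite !mxE.
Qed.

Lemma affine_cons n (a : 'cV[R]_n.+1) c t x :
  a + c *: cons_cV (t, x) =
  cons_cV ((uncons_cV a).1 + c * t, (uncons_cV a).2 + c *: x).
Proof.
apply/colP => i; rewrite 2!mxE; case: (unliftP ord0 i) => [k ->|->].
  by rewrite !cons_cVS/= !mxE.
by rewrite !cons_cV0/=.
Qed.

(** Induction on the dimension: the map acts separately on the first coordinate
and on the others ([affine_cons]). *)
Lemma transport_affine n (a : 'cV[R]_n) (c : R) : c != 0 ->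
  transport (lebesgue_cV n) (lebesgue_cV n) (fun x => a + c *: x) (`|c| ^- n).
Proof.
move=> c0; have k0 m : 0 <= `|c| ^- m by rewrite invr_ge0 exprn_ge0.
elim: n a => [|n IH] a; split => //; try exact: measurable_affine_cV.
  move=> g mg g0 /=.
  rewrite expr0 invr1 mul1e.
  by apply: eq_integral => x _; congr g; apply/colP => -[].
move=> g mg g0.
have mcons := @measurable_cons_cV R n.
have mg' := measurableT_comp mg mcons.
have mG : measurable_fun setT
    (fun t => \int[lebesgue_cV n]_x g (cons_cV (t, x)))%E.
  exact: (measurable_fun_fubini_tonelli_F (m2 := lebesgue_cV n) _ mg' (fun=> g0 _)).
rewrite ge0_integral_cons//; last first.
  by apply: measurableT_comp => //; exact: measurable_affine_cV.
under [LHS]eq_integral => t _.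
  under eq_integral do rewrite affine_cons.
  have [_ _ H] := IH (uncons_cV a).2.
  rewrite (H (fun u => g (cons_cV (((uncons_cV a).1 + c * t)%R, u)))%E)//; last first.
    exact: (measurableT_comp mg' (measurable_pair1 _)).
  over.
rewrite /= ge0_integralZl ?lee_fin//; last 2 first.
- exact: (measurableT_comp mG (measurable_affine _ _)).
- by move=> t _; exact: integral_ge0.
have [_ _ H] := transport_lebesgue_affine (uncons_cV a).1 c0.
rewrite (H (fun t => \int[lebesgue_cV n]_x g (cons_cV (t, x)))%E)//.
  rewrite ge0_integral_cons// muleA -EFinM; congr (_%:E * _)%E.
  by rewrite exprS invfM mulrC.
by move=> t; exact: integral_ge0.
Qed.

Lemma measurable_col_mx m n : measurable_fun setT
  (fun p : 'cV[R]_m * 'cV[R]_n => col_mx p.1 p.2).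
Proof.
apply: measurable_fun_matrixP => i j; rewrite -(splitK i).
case: (fintype.split i) => k /=.
  rewrite (_ : (fun _ => _) = (fun y : 'cV[R]_m => y k j) \o fst).
    by apply: measurableT_comp => //; exact: measurable_entry.
  by apply/funext => p; rewrite col_mxEu.
rewrite (_ : (fun _ => _) = (fun y : 'cV[R]_n => y k j) \o snd).
  by apply: measurableT_comp => //; exact: measurable_entry.
by apply/funext => p; rewrite col_mxEd.
Qed.

Lemma col_mx_cons m n t (x : 'cV[R]_m) (y : 'cV[R]_n) :
  col_mx (cons_cV (t, x) : 'cV[R]_(m.+1)) y = cons_cV (t, col_mx x y) :> 'cV[R]_(m + n).+1.
Proof.
apply/colP => i; case: (unliftP ord0 i) => [k ->|->].
  rewrite cons_cVS/= -(splitK k); case: (fintype.split k) => l /=.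
    rewrite col_mxEu.
    have -> : lift ord0 (lshift n l) = lshift n (lift ord0 l) :> 'I_(m.+1 + n).
      exact: val_inj.
    by rewrite (@col_mxEu _ m.+1 n) cons_cVS.
  rewrite col_mxEd.
  have -> : lift ord0 (rshift m l) = rshift m.+1 l :> 'I_(m.+1 + n).
    exact: val_inj.
  by rewrite (@col_mxEd _ m.+1 n).
have -> : ord0 = lshift n ord0 :> 'I_(m.+1 + n) by exact: val_inj.
rewrite (@col_mxEu _ m.+1 n) cons_cV0.
by rewrite (_ : lshift n ord0 = ord0) ?cons_cV0//; exact: val_inj.
Qed.

(** This is what allows Fubini between positions and frequencies in integrals
over phase space. *)
Lemma transport_col_mx m n : transport (lebesgue_cV m \x lebesgue_cV n)%E
  (lebesgue_cV (m + n)) (fun p => col_mx p.1 p.2 : 'cV[R]_(m + n)) 1.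
Proof.
split => //; first exact: measurable_col_mx.
have mcol := @measurable_col_mx.
move=> g mg g0; rewrite mul1e (fubini_tonelli1 (fun p => g (col_mx p.1 p.2)))//; last first.
  by apply: measurableT_comp => //; exact: mcol.
rewrite /fubini_F/=.
elim: m g mg g0 => [|m IH] g mg g0.
  rewrite integral_dirac//; last first.
    apply: (measurable_fun_fubini_tonelli_F (m2 := lebesgue_cV n)
      (fun p => g (col_mx p.1 p.2))) => //.
    by apply: measurableT_comp => //; exact: mcol.
  rewrite diracT mul1e; apply: eq_integral => y _; congr g.
  apply/colP => i; rewrite mxE; case: fintype.splitP => [[]//|k Ek].
  by congr (y _ _); exact: val_inj.
have mcons k := @measurable_cons_cV R k.
have mg' := measurableT_comp mg (mcons _).
rewrite ge0_integral_cons//; last 2 first.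
- apply: (measurable_fun_fubini_tonelli_F (m2 := lebesgue_cV n)
      (fun p => g (col_mx p.1 p.2))) => //.
  by apply: measurableT_comp => //; exact: mcol.
- by move=> x; exact: integral_ge0.
rewrite [RHS]ge0_integral_cons//.
apply: eq_integral => t _.
under eq_integral do under eq_integral do rewrite col_mx_cons.
apply: (IH (fun z => g (cons_cV (t, z)))) => //.
exact: (measurableT_comp mg' (measurable_pair1 _)).
Qed.

End lebesgue_cV_transport.

(** * Integrals of complex-valued functions *)

Section complex_numbers.
Context {R : realType}.
Implicit Types z w : R[i].

Lemma normcE2 z : Normc.normc z = Num.sqrt (complex.Re z ^+ 2 + complex.Im z ^+ 2).
Proof. by case: z. Qed.

Lemma normc_sqr z : Normc.normc z ^+ 2 = complex.Re z ^+ 2 + complex.Im z ^+ 2.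
Proof. by rewrite normcE2 sqr_sqrtr// addr_ge0// sqr_ge0. Qed.

Lemma normc_ge0 z : 0 <= Normc.normc z.
Proof. by rewrite normcE2 sqrtr_ge0. Qed.

Lemma normr_Re_le z : `|complex.Re z| <= Normc.normc z.
Proof.
by rewrite normcE2 -sqrtr_sqr ler_wsqrtr// lerDl sqr_ge0.
Qed.

Lemma normr_Im_le z : `|complex.Im z| <= Normc.normc z.
Proof.
by rewrite normcE2 -sqrtr_sqr ler_wsqrtr// lerDr sqr_ge0.
Qed.

Lemma normc_le_ReIm z : Normc.normc z <= `|complex.Re z| + `|complex.Im z|.
Proof.
rewrite -(ler_pXn2r (n := 2)) ?nnegrE ?normc_ge0 ?addr_ge0// normc_sqr sqrrD.
rewrite !real_normK ?num_real//.
have := normr_ge0 (complex.Re z); have := normr_ge0 (complex.Im z); nra.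
Qed.

Lemma ReM z w : complex.Re (z * w) =
  complex.Re z * complex.Re w - complex.Im z * complex.Im w.
Proof. by case: z => a b; case: w => c d. Qed.

Lemma ImM z w : complex.Im (z * w) =
  complex.Re z * complex.Im w + complex.Im z * complex.Re w.
Proof. by case: z => a b; case: w => c d. Qed.

Lemma ReD z w : complex.Re (z + w) = complex.Re z + complex.Re w.
Proof. by case: z => a b; case: w => c d. Qed.

Lemma ImD z w : complex.Im (z + w) = complex.Im z + complex.Im w.
Proof. by case: z => a b; case: w => c d. Qed.

Lemma ReN z : complex.Re (- z) = - complex.Re z.
Proof. by case: z. Qed.

Lemma ImN z : complex.Im (- z) = - complex.Im z.
Proof. by case: z. Qed.

Lemma Re_conjc z : complex.Re (z^*) = complex.Re z.
Proof. by case: z. Qed.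

Lemma Im_conjc z : complex.Im (z^*) = - complex.Im z.
Proof. by case: z. Qed.

Lemma normc_conjc z : Normc.normc (z^*) = Normc.normc z.
Proof. by rewrite !normcE2 Re_conjc Im_conjc sqrrN. Qed.

Lemma normc_real (x : R) : Normc.normc x%:C = `|x|.
Proof. by rewrite normcE2/= expr0n/= addr0 sqrtr_sqr. Qed.

Lemma complex_ext z w :
  complex.Re z = complex.Re w -> complex.Im z = complex.Im w -> z = w.
Proof. by case: z => a b; case: w => c d /= -> ->. Qed.

Lemma normc_expi (t : R) : Normc.normc (expi t) = 1.
Proof. by rewrite normcE2/= cos2Dsin2 sqrtr1. Qed.

Lemma expiD (s t : R) : expi (s + t) = expi s * expi t.
Proof.
by apply: complex_ext; rewrite ?ReM ?ImM/= ?cosD ?sinD//; rewrite addrC.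
Qed.

Lemma expi0 : expi (0 : R) = 1.
Proof. by rewrite /expi cos0 sin0. Qed.

Lemma conj_expi (t : R) : Num.conj (expi t) = expi (- t).
Proof. by rewrite /expi cosN sinN. Qed.

End complex_numbers.

Section complex_integral.
Context d (T : measurableType d) (R : realType).
Implicit Types (F G : T -> R[i]) (mu : {measure set T -> \bar R}).

Definition Cmeasurable F :=
  measurable_fun setT (fun t => complex.Re (F t)) /\
  measurable_fun setT (fun t => complex.Im (F t)).

Definition Cintegrable mu F :=
  mu.-integrable setT (fun t => (complex.Re (F t))%:E) /\
  mu.-integrable setT (fun t => (complex.Im (F t))%:E).

Lemma Cmeasurable_cst (c : R[i]) : Cmeasurable (fun=> c).
Proof. by split; exact: measurable_cst. Qed.

Lemma CmeasurableD F G : Cmeasurable F -> Cmeasurable G ->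
  Cmeasurable (fun t => F t + G t).
Proof.
move=> [F1 F2] [G1 G2]; split.
  by under eq_fun do rewrite ReD; exact: measurable_funD.
by under eq_fun do rewrite ImD; exact: measurable_funD.
Qed.

Lemma CmeasurableM F G : Cmeasurable F -> Cmeasurable G ->
  Cmeasurable (fun t => F t * G t).
Proof.
move=> [F1 F2] [G1 G2]; split.
  under eq_fun do rewrite ReM.
  by apply: measurable_funB; exact: measurable_funM.
under eq_fun do rewrite ImM.
by apply: measurable_funD; exact: measurable_funM.
Qed.

Lemma Cmeasurable_conj F : Cmeasurable F -> Cmeasurable (fun t => (F t)^*).
Proof.
move=> [F1 F2]; split.
  by under eq_fun do rewrite Re_conjc.
under eq_fun do rewrite Im_conjc; exact: measurableT_comp.
Qed.

Lemma Cmeasurable_real (g : T -> R) : measurable_fun setT g ->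
  Cmeasurable (fun t => (g t)%:C).
Proof. by move=> mg; split => //=; exact: measurable_cst. Qed.

Lemma Cmeasurable_expi (g : T -> R) : measurable_fun setT g ->
  Cmeasurable (fun t => expi (g t)).
Proof.
move=> mg; split => /=.
  by apply: measurableT_comp => //; apply: continuous_measurable_fun; exact: continuous_cos.
by apply: measurableT_comp => //; apply: continuous_measurable_fun; exact: continuous_sin.
Qed.

Lemma measurable_normc F : Cmeasurable F ->
  measurable_fun setT (fun t => Normc.normc (F t)).
Proof.
move=> [F1 F2]; under eq_fun do rewrite normcE2.
apply: measurableT_comp.
  by apply: continuous_measurable_fun; exact: sqrt_continuous.
by apply: measurable_funD; exact: measurable_funX.
Qed.

Lemma Cintegrable_measurable mu F : Cintegrable mu F -> Cmeasurable F.
Proof. by move=> [/measurable_int/measurable_EFinP ? /measurable_int/measurable_EFinP ?]. Qed.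

Lemma Cintegrable_le mu F (g : T -> R) : Cmeasurable F ->
  mu.-integrable setT (EFin \o g) ->
  (forall t, Normc.normc (F t) <= g t) -> Cintegrable mu F.
Proof.
move=> [mR mI] ig Fg; split; apply: (le_integrable _ _ _ ig) => //=.
- exact/measurable_EFinP.
- move=> t _; rewrite lee_fin (le_trans (normr_Re_le _))// (le_trans (Fg t))//.
  exact: ler_norm.
- exact/measurable_EFinP.
- move=> t _; rewrite lee_fin (le_trans (normr_Im_le _))// (le_trans (Fg t))//.
  exact: ler_norm.
Qed.

Lemma Cintegrable_normc mu F : Cintegrable mu F ->
  mu.-integrable setT (EFin \o (fun t => Normc.normc (F t))).
Proof.
move=> iF; have mF := Cintegrable_measurable iF; case: iF => iR iI.
have /= i2 := integrableD measurableT (integrable_norm iR) (integrable_norm iI).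
apply: (le_integrable _ _ _ i2) => //=.
  exact/measurable_EFinP/measurable_normc.
move=> t _; rewrite lee_fin ger0_norm ?normc_ge0// ger0_norm ?addr_ge0//.
exact: normc_le_ReIm.
Qed.

Lemma Cintegrable_bound mu F G (c : R) : Cintegrable mu F -> Cmeasurable G ->
  (forall t, Normc.normc (G t) <= c) -> Cintegrable mu (fun t => F t * G t).
Proof.
move=> iF mG Gc.
have := integrableZr measurableT c (Cintegrable_normc iF).
move=> /(Cintegrable_le (F := fun t => F t * G t)); apply.
  exact: CmeasurableM (Cintegrable_measurable iF) mG.
by move=> t; rewrite Normc.normcM ler_wpM2l// normc_ge0.
Qed.

Lemma Cintegrable_bounded mu F G : Cintegrable mu F -> Cmeasurable G ->
  (forall t, Normc.normc (G t) <= 1) -> Cintegrable mu (fun t => F t * G t).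
Proof. exact: Cintegrable_bound. Qed.

Lemma CintegrableD mu F G : Cintegrable mu F -> Cintegrable mu G ->
  Cintegrable mu (fun t => F t + G t).
Proof.
move=> [F1 F2] [G1 G2]; split.
  by under eq_fun do rewrite ReD EFinD; exact: integrableD.
by under eq_fun do rewrite ImD EFinD; exact: integrableD.
Qed.

Lemma CintegrableZ mu (c : R[i]) F : Cintegrable mu F ->
  Cintegrable mu (fun t => c * F t).
Proof.
move=> iF; have := integrableZl measurableT (Normc.normc c) (Cintegrable_normc iF).
move=> /(Cintegrable_le (F := fun t => c * F t)); apply.
  exact: CmeasurableM (Cmeasurable_cst c) (Cintegrable_measurable iF).
by move=> t; rewrite Normc.normcM.
Qed.

Lemma eq_Cintegral mu F G : F =1 G -> Cintegral mu F = Cintegral mu G.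
Proof. by move=> /funext ->. Qed.

Lemma CintegralD mu F G : Cintegrable mu F -> Cintegrable mu G ->
  Cintegral mu (fun t => F t + G t) = Cintegral mu F + Cintegral mu G.
Proof.
move=> [F1 F2] [G1 G2]; apply: complex_ext.
  rewrite ReD/=; under eq_Rintegral do rewrite ReD.
  exact: RintegralD.
rewrite ImD/=; under eq_Rintegral do rewrite ImD.
exact: RintegralD.
Qed.

Lemma CintegralZ mu (c : R[i]) F : Cintegrable mu F ->
  Cintegral mu (fun t => c * F t) = c * Cintegral mu F.
Proof.
move=> [F1 F2].
have iZ (a : R) f : mu.-integrable setT (EFin \o f) ->
  mu.-integrable setT (EFin \o (fun t => a * f t)).
  by move=> /(integrableZl measurableT a).
apply: complex_ext.
  rewrite ReM/=; under eq_Rintegral do rewrite ReM.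
  by rewrite RintegralB// ?RintegralZl//; apply: iZ.
rewrite ImM/=; under eq_Rintegral do rewrite ImM.
by rewrite RintegralD// ?RintegralZl//; apply: iZ.
Qed.

Lemma Cintegral_conj mu F : Cintegrable mu F ->
  Cintegral mu (fun t => (F t)^*) = (Cintegral mu F)^*.
Proof.
move=> [F1 F2]; apply: complex_ext.
  by rewrite Re_conjc/=; under eq_Rintegral do rewrite Re_conjc.
rewrite Im_conjc/=; under eq_Rintegral do rewrite Im_conjc -mulN1r.
by rewrite RintegralZl// mulN1r.
Qed.

Definition Ccvg (u : nat -> R[i]) (l : R[i]) :=
  (complex.Re (u n) @[n --> \oo] --> complex.Re l) /\
  (complex.Im (u n) @[n --> \oo] --> complex.Im l).

Lemma Rintegral_dct mu (f_ : nat -> T -> R) (f g : T -> R) :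
  (forall n, measurable_fun setT (f_ n)) -> measurable_fun setT f ->
  (forall t, f_ n t @[n --> \oo] --> f t) ->
  mu.-integrable setT (EFin \o g) ->
  (forall n t, `|f_ n t| <= g t) ->
  \int[mu]_t f_ n t @[n --> \oo] --> \int[mu]_t f t.
Proof.
move=> mf_ mf ff ig fg.
have ff' t : (EFin \o f_ ^~ t) n @[n --> \oo] --> (f t)%:E.
  by apply: cvg_EFin; [exact: nearW|exact: ff].
have [iF _ H] := @dominated_convergence _ _ _ mu setT measurableT
  (fun n => EFin \o f_ n) (EFin \o f) (EFin \o g)
  (fun n => iffRL (measurable_EFinP _ _) (mf_ n)) (iffRL (measurable_EFinP _ _) mf)
  (aeW _ (fun t _ => ff' t)) ig (aeW _ (fun t n _ => fg n t)).
have fin : (\int[mu]_t (f t)%:E)%E \is a fin_num by exact: integrable_fin_num.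
by apply: (@fine_cvg R); rewrite /Rintegral fineK.
Qed.

Lemma Cintegral_dct mu (F_ : nat -> T -> R[i]) F (g : T -> R) :
  (forall n, Cmeasurable (F_ n)) -> Cmeasurable F ->
  (forall t, Ccvg (F_ ^~ t) (F t)) ->
  mu.-integrable setT (EFin \o g) ->
  (forall n t, Normc.normc (F_ n t) <= g t) ->
  Ccvg (fun n => Cintegral mu (F_ n)) (Cintegral mu F).
Proof.
move=> mF_ [mR mI] FF ig Fg; split => /=; apply: (@Rintegral_dct _ _ _ g) => //.
- by move=> n; have [] := mF_ n.
- by move=> t; have [] := FF t.
- by move=> n t; rewrite (le_trans (normr_Re_le _)).
- by move=> n; have [] := mF_ n.
- by move=> t; have [] := FF t.
- by move=> n t; rewrite (le_trans (normr_Im_le _)).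
Qed.

End complex_integral.

Section Ccvg.
Context {R : realType}.
Implicit Types u v : nat -> R[i].

Lemma Ccvg_unique u (l m : R[i]) : Ccvg u l -> Ccvg u m -> l = m.
Proof.
move=> [u1 u2] [v1 v2]; apply: complex_ext.
  by have := @cvg_unique _ (@norm_hausdorff _ R) _ _ _ _ u1 v1; exact.
by have := @cvg_unique _ (@norm_hausdorff _ R) _ _ _ _ u2 v2; exact.
Qed.

Lemma Ccvg_cst (c : R[i]) : Ccvg (fun=> c) c.
Proof. by split; exact: cvg_cst. Qed.

Lemma CcvgM u v (l m : R[i]) : Ccvg u l -> Ccvg v m ->
  Ccvg (fun n => u n * v n) (l * m).
Proof.
move=> [u1 u2] [v1 v2]; split.
  rewrite ReM; under eq_fun do rewrite ReM.
  by apply: cvgB; exact: cvgM.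
rewrite ImM; under eq_fun do rewrite ImM.
by apply: cvgD; exact: cvgM.
Qed.

End Ccvg.

Section complex_transport.
Context d1 d2 (T1 : measurableType d1) (T2 : measurableType d2) (R : realType).

Lemma Cmeasurable_comp (F : T2 -> R[i]) (phi : T1 -> T2) : Cmeasurable F ->
  measurable_fun setT phi -> Cmeasurable (fun x => F (phi x)).
Proof.
move=> [F1 F2] mphi; split.
  exact: (measurableT_comp F1 mphi).
exact: (measurableT_comp F2 mphi).
Qed.

Context (mu : {measure set T1 -> \bar R}) (nu : {measure set T2 -> \bar R}).
Variables (phi : T1 -> T2) (k : R).
Hypothesis tr : transport mu nu phi k.

Lemma transport_Cintegrable (F : T2 -> R[i]) : Cintegrable nu F ->
  Cintegrable mu (fun x => F (phi x)).
Proof.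
by move=> [F1 F2]; split;
  [exact: (transport_integrable tr F1)|exact: (transport_integrable tr F2)].
Qed.

Lemma transport_Cintegral (F : T2 -> R[i]) : Cintegrable nu F ->
  Cintegral mu (fun x => F (phi x)) = k%:C * Cintegral nu F.
Proof.
move=> [F1 F2]; apply: complex_ext.
  by rewrite ReM/= mul0r subr0 (transport_Rintegral tr F1).
by rewrite ImM/= mul0r addr0 (transport_Rintegral tr F2).
Qed.

End complex_transport.

Section complex_fubini.
Context d1 d2 (T1 : measurableType d1) (T2 : measurableType d2) (R : realType).
Variables (m1 : {sigma_finite_measure set T1 -> \bar R})
  (m2 : {sigma_finite_measure set T2 -> \bar R}).

Lemma integral_fine d (T : measurableType d) (mu : {measure set T -> \bar R})
    (f : T -> \bar R) : measurable_fun setT f ->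
  {ae mu, forall x, f x \is a fin_num} ->
  (\int[mu]_x (fine (f x))%:E = \int[mu]_x f x)%E.
Proof.
move=> mf ffin; apply: ae_eq_integral => //.
  by apply/measurable_EFinP; exact: measurableT_comp.
by apply: filterS ffin => x ffin _; rewrite fineK.
Qed.

Lemma Rintegral_fubini12 (f : T1 * T2 -> R) :
  (m1 \x m2)%E.-integrable setT (EFin \o f) ->
  \int[(m1 \x m2)%E]_z f z = \int[m1]_x \int[m2]_y f (x, y).
Proof.
move=> intf; rewrite /Rintegral; congr fine.
rewrite -(integral12_prod_meas1 intf) [RHS]integral_fine//.
  exact: (measurable_fubini_F intf).
by apply: filterS (ae_integrable1 intf) => x; exact: integrable_fin_num.
Qed.

Lemma Rintegral_fubini21 (f : T1 * T2 -> R) :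
  (m1 \x m2)%E.-integrable setT (EFin \o f) ->
  \int[(m1 \x m2)%E]_z f z = \int[m2]_y \int[m1]_x f (x, y).
Proof.
move=> intf; rewrite /Rintegral; congr fine.
rewrite -(integral21_prod_meas1 intf) [RHS]integral_fine//.
  exact: (measurable_fubini_G intf).
by apply: filterS (ae_integrable2 intf) => x; exact: integrable_fin_num.
Qed.

Lemma Cintegral_fubini12 (F : T1 * T2 -> R[i]) :
  Cintegrable (m1 \x m2)%E F ->
  Cintegral (m1 \x m2)%E F = Cintegral m1 (fun x => Cintegral m2 (fun y => F (x, y))).
Proof.
by move=> [F1 F2]; apply: complex_ext; rewrite /= Rintegral_fubini12.
Qed.

Lemma Cintegral_fubini21 (F : T1 * T2 -> R[i]) :
  Cintegrable (m1 \x m2)%E F ->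
  Cintegral (m1 \x m2)%E F = Cintegral m2 (fun y => Cintegral m1 (fun x => F (x, y))).
Proof.
by move=> [F1 F2]; apply: complex_ext; rewrite /= Rintegral_fubini21.
Qed.

Lemma Cintegral_swap (F : T1 * T2 -> R[i]) :
  Cintegrable (m1 \x m2)%E F ->
  Cintegral m1 (fun x => Cintegral m2 (fun y => F (x, y))) =
  Cintegral m2 (fun y => Cintegral m1 (fun x => F (x, y))).
Proof.
by move=> iF; rewrite -Cintegral_fubini12// Cintegral_fubini21.
Qed.

Lemma integrable_prodfun (f : T1 -> R) (g : T2 -> R) :
  m1.-integrable setT (EFin \o f) -> m2.-integrable setT (EFin \o g) ->
  (m1 \x m2)%E.-integrable setT (EFin \o (fun p => f p.1 * g p.2)).
Proof.
move=> /integrableP[/measurable_EFinP mf foo] /integrableP[/measurable_EFinP mg goo].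
apply/integrable12ltyP.
  apply/measurable_EFinP; apply: measurable_funM.
    exact: (measurableT_comp mf).
  exact: (measurableT_comp mg).
rewrite /=.
under eq_integral => x _.
  under eq_integral do rewrite normrM EFinM.
  rewrite ge0_integralZl//; last first.
    by apply/measurable_EFinP; exact: measurableT_comp.
  over.
rewrite ge0_integralZr//; last first.
- exact: integral_ge0.
- by apply/measurable_EFinP; exact: measurableT_comp.
by rewrite lte_mul_pinfty// ?integral_ge0// ge0_fin_numE// integral_ge0.
Qed.

Lemma Cintegrable_prodfun (F : T1 -> R[i]) (G : T2 -> R[i]) :
  Cintegrable m1 F -> Cintegrable m2 G ->
  Cintegrable (m1 \x m2)%E (fun p => F p.1 * G p.2).
Proof.
move=> iF iG.
apply: (Cintegrable_le _ (integrable_prodfun (Cintegrable_normc iF) (Cintegrable_normc iG))).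
  apply: CmeasurableM.
    exact: (Cmeasurable_comp (Cintegrable_measurable iF)).
  exact: (Cmeasurable_comp (Cintegrable_measurable iG)).
by move=> p; rewrite Normc.normcM.
Qed.

Lemma Cintegral_prodfun (F : T1 -> R[i]) (G : T2 -> R[i]) :
  Cintegrable m1 F -> Cintegrable m2 G ->
  Cintegral (m1 \x m2)%E (fun p => F p.1 * G p.2) =
  Cintegral m1 F * Cintegral m2 G.
Proof.
move=> iF iG; rewrite Cintegral_fubini12; last exact: Cintegrable_prodfun.
rewrite (@eq_Cintegral _ _ _ _ _ (fun x => Cintegral m2 G * F x)).
  by rewrite CintegralZ// mulrC.
by move=> x /=; rewrite (CintegralZ (F x) iG) mulrC.
Qed.

End complex_fubini.

Lemma cvge0P (R : realType) (u : nat -> \bar R) : (forall k, 0 <= u k)%E ->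
  u @ \oo --> 0%E <->
  (forall e : R, 0 < e -> \forall k \near \oo, (u k <= e%:E)%E).
Proof.
move=> u0; split=> [/fine_cvgP[fu cu] e e0|H].
  move/cvgrPdist_le : cu => /(_ e e0) cu; near=> k.
  have fk : u k \is a fin_num by near: k.
  have : `|0 - fine (u k)| <= e by near: k.
  by rewrite sub0r normrN ger0_norm ?fine_ge0// -lee_fin fineK.
apply/fine_cvgP; split.
  near=> k; rewrite ge0_fin_numE//.
  have : (u k <= 1%:E)%E by near: k; exact: H.
  by move=> /le_lt_trans; apply; rewrite ltry.
apply/cvgrPdist_le => e e0; near=> k.
have uk : (u k <= e%:E)%E by near: k; exact: H.
rewrite sub0r normrN ger0_norm ?fine_ge0//= -lee_fin fineK// ge0_fin_numE//.
by rewrite (le_lt_trans uk)// ltry.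
Unshelve. all: by end_near. Qed.

Section complex_integral_more.
Context d1 d2 (T1 : measurableType d1) (T2 : measurableType d2) (R : realType).
Variables (m1 : {sigma_finite_measure set T1 -> \bar R})
  (m2 : {sigma_finite_measure set T2 -> \bar R}).

Lemma Cmeasurable_fubini (F : T1 * T2 -> R[i]) : Cmeasurable F ->
  Cmeasurable (fun x => Cintegral m2 (fun y => F (x, y))).
Proof.
have H (f : T1 * T2 -> R) : measurable_fun setT f ->
    measurable_fun setT (fun x => \int[m2]_y f (x, y)).
  move=> mf; have mf' : measurable_fun setT (EFin \o f) by exact/measurable_EFinP.
  apply: (measurableT_comp (f := fine)) => //.
  rewrite (_ : (fun x => \int[m2]_y (f (x, y))%:E)%E =
    (fun x => \int[m2]_y (EFin \o f)^\+ (x, y) - \int[m2]_y (EFin \o f)^\- (x, y))%E).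
    apply: emeasurable_funB.
      exact: (measurable_fun_fubini_tonelli_F (m2 := m2) _ (measurable_funepos mf') (funepos_ge0 _)).
    exact: (measurable_fun_fubini_tonelli_F (m2 := m2) _ (measurable_funeneg mf') (funeneg_ge0 _)).
  apply/funext => x; rewrite [LHS]integralE; congr (_ - _)%E.
    by apply: eq_integral => y _; rewrite !funeposE.
  by apply: eq_integral => y _; rewrite !funenegE.
by move=> [F1 F2]; split; [exact: (H _ F1)|exact: (H _ F2)].
Qed.

Lemma Cintegrable_tonelli21 (F : T1 * T2 -> R[i]) : Cmeasurable F ->
  (\int[m2]_y \int[m1]_x (Normc.normc (F (x, y)))%:E < +oo)%E ->
  Cintegrable (m1 \x m2)%E F.
Proof.
move=> mF Foo; apply: (@Cintegrable_le _ _ _ _ _ (fun p => Normc.normc (F p))) => //.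
apply/integrable21ltyP.
  by apply/measurable_EFinP; exact: measurable_normc.
under eq_integral do under eq_integral do rewrite /= ger0_norm ?normc_ge0//.
exact: Foo.
Qed.

Lemma normr_Rintegral_le (mu : {measure set T1 -> \bar R}) (f g : T1 -> R) (c : R) :
  mu.-integrable setT (EFin \o f) -> measurable_fun setT g ->
  (forall t, `|f t| <= g t) -> (\int[mu]_t (g t)%:E <= c%:E)%E ->
  `|\int[mu]_t f t| <= c.
Proof.
move=> iF mg fg gc; rewrite -lee_fin EFin_normr_Rintegral//.
apply: le_trans gc; apply: le_trans.
  apply: le_abse_integral => //; exact: (measurable_int _ iF).
apply: ge0_le_integral => //=.
- by apply/measurable_EFinP; apply: measurableT_comp => //; apply/measurable_EFinP; exact: (measurable_int _ iF).
- exact/measurable_EFinP.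
- by move=> t _; rewrite lee_fin.
Qed.

(** Convergence in [L^1] is asked through a real bound [g_ k] of the distance,
which need not be the distance itself. *)
Lemma Cintegral_L1cvg (mu : {measure set T1 -> \bar R}) (F_ : nat -> T1 -> R[i]) (F : T1 -> R[i])
    (g_ : nat -> T1 -> R) :
  (forall k, Cintegrable mu (F_ k)) -> Cintegrable mu F ->
  (forall k, measurable_fun setT (g_ k)) ->
  (forall k t, Normc.normc (F_ k t - F t) <= g_ k t) ->
  (fun k => \int[mu]_t (g_ k t)%:E)%E @ \oo --> 0%E ->
  Ccvg (fun k => Cintegral mu (F_ k)) (Cintegral mu F).
Proof.
move=> iF_ iF mg Fg /cvge0P cg.
have g0 k t : 0 <= g_ k t by exact: le_trans (normc_ge0 _) (Fg k t).
have {}cg : forall e : R, 0 < e -> \forall k \near \oo, (\int[mu]_t (g_ k t)%:E <= e%:E)%E.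
  by apply: cg => k; apply: integral_ge0 => t _; rewrite lee_fin.
split; apply/cvgrPdist_le => e e0; apply: filterS (cg e e0) => k ge /=.
  rewrite distrC -RintegralB//; [|exact: (iF_ k).1|exact: iF.1].
  apply: (normr_Rintegral_le _ (mg k) _ ge).
    exact: (integrableB measurableT (iF_ k).1 iF.1).
  by move=> t; rewrite -ReN -ReD (le_trans (normr_Re_le _)).
rewrite distrC -RintegralB//; [|exact: (iF_ k).2|exact: iF.2].
apply: (normr_Rintegral_le _ (mg k) _ ge).
  exact: (integrableB measurableT (iF_ k).2 iF.2).
by move=> t; rewrite -ImN -ImD (le_trans (normr_Im_le _)).
Qed.

Lemma normc_Cintegral_le (mu : {measure set T1 -> \bar R}) (F : T1 -> R[i]) (g : T1 -> R) (c : R) :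
  Cintegrable mu F -> measurable_fun setT g ->
  (forall t, Normc.normc (F t) <= g t) -> (\int[mu]_t (g t)%:E <= c%:E)%E ->
  Normc.normc (Cintegral mu F) <= 2 * c.
Proof.
move=> iF mg Fg gc; rewrite (le_trans (normc_le_ReIm _))// mulr_natl mulr2n lerD//.
  apply: (normr_Rintegral_le iF.1 mg _ gc) => t.
  by rewrite (le_trans (normr_Re_le _)).
apply: (normr_Rintegral_le iF.2 mg _ gc) => t.
by rewrite (le_trans (normr_Im_le _)).
Qed.

End complex_integral_more.

Section finite_sums.
Context d (T : measurableType d) (R : realType) (mu : {measure set T -> \bar R}).

Lemma Rintegral_sum I (r : seq I) (F : I -> T -> R) :
  (forall i, mu.-integrable setT (EFin \o F i)) ->
  \int[mu]_t (\sum_(i <- r) F i t) = \sum_(i <- r) \int[mu]_t F i t.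
Proof.
move=> iF; elim: r => [|i r IH].
  by under eq_Rintegral do rewrite big_nil; rewrite big_nil /Rintegral integral0.
rewrite big_cons -IH -RintegralD//; last first.
  have := @integrable_sum _ _ _ mu setT measurableT _ r xpredT _ (fun i _ => iF i).
  by apply: eq_integrable => // t _; rewrite /= -sumEFin.
by apply: eq_Rintegral => t _; rewrite big_cons.
Qed.

Lemma Cintegrable_sum I (r : seq I) (F : I -> T -> R[i]) :
  (forall i, Cintegrable mu (F i)) -> Cintegrable mu (fun t => \sum_(i <- r) F i t).
Proof.
move=> iF; elim: r => [|i r IH].
  under [X in Cintegrable _ X]eq_fun do rewrite big_nil.
  by split; exact: integrable0.
under [X in Cintegrable _ X]eq_fun do rewrite big_cons.
exact: CintegrableD.
Qed.

Lemma Cintegral_sum I (r : seq I) (F : I -> T -> R[i]) :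
  (forall i, Cintegrable mu (F i)) ->
  Cintegral mu (fun t => \sum_(i <- r) F i t) = \sum_(i <- r) Cintegral mu (F i).
Proof.
move=> iF; elim: r => [|i r IH].
  rewrite big_nil; under eq_Cintegral do rewrite big_nil.
  by apply: complex_ext; rewrite /= /Rintegral integral0.
rewrite big_cons -IH -CintegralD//; last exact: Cintegrable_sum.
by apply: eq_Cintegral => t; rewrite big_cons.
Qed.

End finite_sums.

(** * Continuity of translations in mean square *)

Section square_integrals.
Context d (T : measurableType d) (R : realType).
Variable m : {measure set T -> \bar R}.
Implicit Types u v w : T -> R.
Local Notation N2 u := (\int[m]_x ((u x) ^+ 2)%:E)%E.

Lemma integral_sqr_ge0 u : (0 <= N2 u)%E.
Proof. by apply: integral_ge0 => x _; rewrite lee_fin sqr_ge0. Qed.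

Lemma integral_sqr_le u v : measurable_fun setT u -> measurable_fun setT v ->
  (forall x, `|u x| <= `|v x|) -> (N2 u <= N2 v)%E.
Proof.
move=> mu mv uv; apply: ge0_le_integral => //=.
- by move=> x _; rewrite lee_fin sqr_ge0.
- by apply/measurable_EFinP; exact: measurable_funX.
- by apply/measurable_EFinP; exact: measurable_funX.
- by move=> x _; rewrite lee_fin -real_normK ?num_real// -[leRHS]real_normK ?num_real// ler_pXn2r ?nnegrE.
Qed.

Lemma integral_sqr_D u v : measurable_fun setT u -> measurable_fun setT v ->
  (N2 (fun x => u x + v x) <= 2%:E * (N2 u + N2 v))%E.
Proof.
move=> mu mv.
have m2 w : measurable_fun setT w -> measurable_fun setT (fun x => ((w x) ^+ 2)%:E).
  by move=> mw; apply/measurable_EFinP; exact: measurable_funX.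
rewrite -ge0_integralD//; [|by move=> x _; rewrite lee_fin sqr_ge0|exact: m2|
  by move=> x _; rewrite lee_fin sqr_ge0|exact: m2].
rewrite -ge0_integralZl//; last 2 first.
- by apply: emeasurable_funD; exact: m2.
- by move=> x _; rewrite adde_ge0// lee_fin sqr_ge0.
apply: ge0_le_integral => //=.
- by move=> x _; rewrite lee_fin sqr_ge0.
- by apply: m2; exact: measurable_funD.
- by apply: measurable_funeM; apply: emeasurable_funD; exact: m2.
- move=> x _; rewrite -EFinD -EFinM lee_fin.
  have := sqr_ge0 (u x - v x); rewrite sqrrB sqrrD; lra.
Qed.

Lemma integral_sqrB_sym u v : N2 (fun x => u x - v x) = N2 (fun x => v x - u x).
Proof. by apply: eq_integral => x _; rewrite -sqrrN opprB. Qed.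

(** Cauchy-Schwarz would bound the integral; Young's inequality
[p q <= l p^2 / 2 + q^2 / (2 l)] with a large weight [l] is enough. *)
Lemma cvg0_integralM (p q : nat -> T -> R) (C : R) :
  (forall k, measurable_fun setT (p k)) -> (forall k, measurable_fun setT (q k)) ->
  (forall k x, 0 <= p k x) -> (forall k x, 0 <= q k x) ->
  (fun k => N2 (p k)) @ \oo --> 0%E ->
  (forall k, N2 (q k) <= C%:E)%E ->
  (fun k => \int[m]_x (p k x * q k x)%:E)%E @ \oo --> 0%E.
Proof.
move=> mp mq p0 q0 cp qC.
have C0 : 0 <= C by rewrite -lee_fin (le_trans _ (qC 0%N))// integral_sqr_ge0.
have C1 : 0 < C + 1 by rewrite ltr_wpDl.
have mX w : measurable_fun setT w -> measurable_fun setT (fun x => ((w x) ^+ 2)%:E).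
  by move=> mw; apply/measurable_EFinP; exact: measurable_funX.
have /cvge0P {}cp := cp.
apply/cvge0P.
  by move=> k; apply: integral_ge0 => x _; rewrite lee_fin mulr_ge0.
(* With this weight each of the two terms is at most [e / 2]. *)
move=> e e0; pose l := (C + 1) / e.
have l0 : 0 < l by exact: divr_gt0.
near=> k.
have pk : (N2 (p k) <= (e / l)%:E)%E.
  by near: k; apply: cp; [move=> k; exact: integral_sqr_ge0|exact: divr_gt0].
apply: (@le_trans _ _ ((l / 2)%:E * N2 (p k) + (l^-1 / 2)%:E * N2 (q k))%E).
  rewrite -!ge0_integralZl//; [|exact: mX|by move=> x _; rewrite lee_fin sqr_ge0
    |by rewrite lee_fin ltW// divr_gt0// invr_gt0|exact: mX|
    by move=> x _; rewrite lee_fin sqr_ge0|by rewrite lee_fin ltW// divr_gt0].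
  rewrite -ge0_integralD//; last 4 first.
  - by move=> x _; rewrite mule_ge0// lee_fin ?sqr_ge0// ltW// divr_gt0.
  - by apply: measurable_funeM; exact: mX.
  - by move=> x _; rewrite mule_ge0// lee_fin ?sqr_ge0// ltW// divr_gt0// invr_gt0.
  - by apply: measurable_funeM; exact: mX.
  apply: ge0_le_integral => //=.
  - by move=> x _; rewrite lee_fin mulr_ge0.
  - by apply/measurable_EFinP; exact: measurable_funM.
  - by apply: emeasurable_funD; apply: measurable_funeM; exact: mX.
  - move=> x _; rewrite -!EFinM -EFinD lee_fin.
    have := sqr_ge0 (l * p k x - q k x) => H.
    have : 0 <= (l * p k x - q k x) ^+ 2 / (2 * l) by rewrite divr_ge0// mulr_ge0// ltW.
    have -> : (l * p k x - q k x) ^+ 2 / (2 * l) =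
        l / 2 * p k x ^+ 2 + l^-1 / 2 * q k x ^+ 2 - p k x * q k x.
      by field; rewrite gt_eqF.
    lra.
apply: (@le_trans _ _ ((l / 2)%:E * (e / l)%:E + (l^-1 / 2)%:E * C%:E)%E).
  by rewrite leeD// lee_pmul2l// ?lte_fin ?divr_gt0// ?invr_gt0.
rewrite -!EFinM -EFinD lee_fin.
have -> : l / 2 * (e / l) = e / 2 by field; rewrite gt_eqF.
have -> : l^-1 / 2 * C = e / 2 * (C / (C + 1)) by rewrite /l; field; rewrite !gt_eqF.
have : C / (C + 1) <= 1 by rewrite ler_pdivrMr// mul1r lerDl.
have : 0 < e / 2 by rewrite divr_gt0.
nra.
Unshelve. all: by end_near. Qed.

End square_integrals.

Section dominated_to_zero.
Context d (T : measurableType d) (R : realType).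
Variable m : {measure set T -> \bar R}.
Local Open Scope ereal_scope.

(** The pointwise limit is asked only where the bound is finite: the slices of a
square-integrable function are square-integrable only almost everywhere. *)
Lemma cvg0_integral_dominated (A : nat -> T -> \bar R) (B : T -> \bar R) (c : R) :
  (forall k, measurable_fun setT (A k)) -> measurable_fun setT B ->
  (forall k x, 0 <= A k x) -> (forall x, 0 <= B x) -> (0 <= c)%R ->
  \int[m]_x B x < +oo -> (forall k x, A k x <= c%:E * B x) ->
  {ae m, forall x, B x < +oo -> A ^~ x @ \oo --> 0} ->
  (fun k => \int[m]_x A k x) @ \oo --> 0.
Proof.
move=> mA mB A0 B0 c0 Boo AB cA.
have iB : m.-integrable setT B.
  by apply/integrableP; split => //; under eq_integral do rewrite gee0_abs//.
have ae1 : {ae m, forall x, setT x -> A ^~ x @ \oo --> cst 0 x}.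
  apply: filterS2 (integrable_ae measurableT iB) cA => x /(_ I) Bx cAx _.
  by apply: cAx; rewrite ltey_eq Bx.
have ae2 : {ae m, forall x k, setT x -> `|A k x| <= c%:E * B x}.
  by apply: aeW => x k _; rewrite gee0_abs.
have [_ _] := dominated_convergence measurableT mA (measurable_cst _) ae1
  (integrableZl measurableT c iB) ae2.
by rewrite integral0.
Qed.

End dominated_to_zero.

Lemma clip_le (R : realFieldType) (M y : R) : 0 <= M ->
  `|Num.max (- M) (Num.min M y)| <= M.
Proof.
by move=> M0; rewrite ler_norml le_max lexx/= ge_max ge_min lexx/= andbT; lra.
Qed.

Lemma clip_dist (R : realFieldType) (M x y : R) : `|x| <= M ->
  `|x - Num.max (- M) (Num.min M y)| <= `|x - y|.
Proof.
rewrite ler_norml => /andP[h1 h2]; case: (leP M y) => h3.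
  rewrite max_r; last lra.
  by case: (ger0P (x - y)) => h4; rewrite ler_norml; apply/andP; split; lra.
case: (leP (- M) y) => h4 //.
by case: (ger0P (x - y)) => h5; rewrite ler_norml; apply/andP; split; lra.
Qed.

(** Away from its endpoints, the indicator of [[-M, M]] is locally constant. *)
Lemma near_norm_le (R : realType) (M x : R) (h : nat -> R) :
  h @ \oo --> 0 -> `|x| != M ->
  \forall k \near \oo, (`|x + h k| <= M) = (`|x| <= M).
Proof.
move=> h0 xM.
have d0 : 0 < `| `|x| - M | by rewrite normr_gt0 subr_eq0.
near=> k.
have hk : `|h k| < `| `|x| - M | by near: k; exact: (cvgr0_norm_lt _ h0).
apply/idP/idP => h1.
  have := lerB_normD x (h k); case: (ger0P (`|x| - M)) hk; lra.
have := ler_normD x (h k); move: xM; rewrite neq_lt => /orP[] h2.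
  by move: hk; rewrite [`| _ - M|]ltr0_norm ?subr_lt0//; lra.
by move: h1; rewrite leNgt h2.
Unshelve. all: by end_near. Qed.

Section translation_1d.
Context {R : realType}.
Local Notation mu := (@lebesgue_measure R).
Local Notation N2 u := (\int[mu]_x ((u x) ^+ 2)%:E)%E.

Lemma integral_sqr_shift (f : R -> R) (h : R) : measurable_fun setT f ->
  N2 (fun x => f (x + h)) = N2 f.
Proof.
move=> mf; have [_ _ H] := @transport_lebesgue_affine R h 1 (oner_neq0 _).
have := H (fun x => ((f x) ^+ 2)%:E).
rewrite normr1 invr1 mul1e => <-.
- by apply: eq_integral => x _; rewrite mul1r addrC.
- by apply/measurable_EFinP; exact: measurable_funX.
- by move=> y; rewrite lee_fin sqr_ge0.
Qed.

Lemma measurable_shift (f : R -> R) (h : R) : measurable_fun setT f ->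
  measurable_fun setT (fun x : R => f (x + h)).
Proof.
by move=> mf; apply: (measurableT_comp mf); exact: measurable_funD.
Qed.

(** Translations are isometries, so the functions on which they are continuous
form a closed set for the [L^2] distance. *)
Lemma translation_closed (f : R -> R) (h : nat -> R) : measurable_fun setT f ->
  (forall e : R, 0 < e -> exists g : R -> R, [/\ measurable_fun setT g,
     (N2 (fun x : R => f x - g x)%R <= e%:E)%E &
     (fun k => N2 (fun x : R => g (x + h k) - g x)%R) @ \oo --> 0%E]) ->
  (fun k => N2 (fun x : R => f (x + h k) - f x)%R) @ \oo --> 0%E.
Proof.
move=> mf H; apply/cvge0P; first by move=> k; exact: integral_sqr_ge0.
(* Two uses of [(a + b)^2 <= 2 (a^2 + b^2)] combine three errors [e / 16]. *)
move=> e e0; have [g [mg fg /cvge0P cg]] := H (e / 16) (divr_gt0 e0 (ltr0n _ 16)).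
near=> k.
have gk : (N2 (fun x : R => g (x + h k) - g x)%R <= (e / 16)%:E)%E.
  by near: k; apply: cg; [move=> k; exact: integral_sqr_ge0|rewrite divr_gt0].
pose u (x : R) := f (x + h k) - g (x + h k).
pose v (x : R) := g (x + h k) - g x.
pose w (x : R) := g x - f x.
have mB (a b : R -> R) : measurable_fun setT a -> measurable_fun setT b ->
  measurable_fun setT (fun x : R => a x - b x) by exact: measurable_funB.
have mu' : measurable_fun setT u by apply: mB; exact: measurable_shift.
have mv : measurable_fun setT v by apply: mB => //; exact: measurable_shift.
have mw : measurable_fun setT w by exact: mB.
have -> : N2 (fun x : R => f (x + h k) - f x)%R = N2 (fun x => u x + (v x + w x))%R.
  by apply: eq_integral => x _; congr (_ ^+ 2)%:E; rewrite /u /v /w; lra.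
have Nu : (N2 u <= (e / 16)%:E)%E.
  by rewrite (integral_sqr_shift (h k) (mB _ _ mf mg)).
have Nw : (N2 w <= (e / 16)%:E)%E by rewrite integral_sqrB_sym.
have mvw : measurable_fun setT (fun x : R => v x + w x) by exact: measurable_funD.
apply: (le_trans (integral_sqr_D mu mu' mvw)).
apply: (@le_trans _ _ (2%:E * ((e / 16)%:E + (2%:E * ((e / 16)%:E + (e / 16)%:E)))))%E.
  rewrite lee_pmul2l// leeD//.
  apply: (le_trans (integral_sqr_D mu mv mw)).
  by rewrite lee_pmul2l// leeD.
rewrite -!(EFinD, EFinM) lee_fin; lra.
Unshelve. all: by end_near. Qed.

(** Density: a cut-off [fm m] of [f], in value and in support, is approximated in
[L^1] by a continuous function. Clipping the latter at the same height keeps the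
distance under control and makes it bounded, so the approximation also holds in
[L^2]. On the result, a continuous function times the indicator of an interval,
dominated convergence applies away from the two endpoints. *)
Lemma L2_translation_1d (f : R -> R) (h : nat -> R) : measurable_fun setT f ->
  (N2 f < +oo)%E -> h @ \oo --> 0 ->
  (fun k => N2 (fun x : R => f (x + h k) - f x)%R) @ \oo --> 0%E.
Proof.
move=> mf foo h0; apply: translation_closed => // e e0.
have mX (w : R -> R) : measurable_fun setT w -> measurable_fun setT (fun x : R => ((w x) ^+ 2)%:E).
  by move=> mw; apply/measurable_EFinP; exact: measurable_funX.
pose D (m : nat) : set R := `[- m%:R, m%:R] `&` f @^-1` `[- m%:R, m%:R].
have mD m : measurable (D m).
  by apply: measurableI => //; rewrite -[X in measurable X]setTI; exact: mf.
pose fm m (x : R) := f x * \1_(D m) x.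
have mfm m : measurable_fun setT (fm m) by apply: measurable_funM => //; exact: measurable_indic.
have cutoff : (fun m => N2 (fun x : R => f x - fm m x)%R) @ \oo --> 0%E.
  apply: (@cvg0_integral_dominated _ _ _ mu _ (fun x => ((f x) ^+ 2)%:E) 1) => //.
  - by move=> m; apply: mX; exact: measurable_funB.
  - exact: mX.
  - by move=> m x; rewrite lee_fin sqr_ge0.
  - by move=> x; rewrite lee_fin sqr_ge0.
  - move=> m x; rewrite mul1e lee_fin /fm indicE.
    by case: (_ \in _); rewrite ?mulr1 ?mulr0 ?subr0// subrr expr0n sqr_ge0.
  - apply: aeW => x _; apply: cvg_near_cst; near=> m.
    rewrite /fm indicE mem_set ?mulr1 ?subrr ?expr0n//.
    by split => /=; rewrite in_itv/= -ler_norml; near: m; exact: nbhs_infty_ger.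
have /cvge0P cut := cutoff.
have [m _ /(_ m (leqnn m)) fmE] : \forall m \near \oo,
    (N2 (fun x : R => f x - fm m x)%R <= (e / 4)%:E)%E.
  by apply: cut; [move=> k; exact: integral_sqr_ge0|rewrite divr_gt0].
pose M : R := m%:R; have M0 : 0 <= M by exact: ler0n.
pose E : set R := `[- M, M]%classic.
have mE : measurable E by exact: measurable_itv.
have Efin : (mu E < +oo)%E by rewrite lebesgue_measure_itv/=; case: ifP => _; rewrite ?ltry// -EFinB ltry.
have fmM x : `|fm m x| <= M.
  rewrite /fm indicE; case: (boolP (x \in D m)) => [|_]; last by rewrite mulr0 normr0.
  by rewrite inE mulr1 => -[_ /=]; rewrite in_itv/= ler_norml.
have fmE0 x : ~ E x -> fm m x = 0.
  by move=> Ex; rewrite /fm indicE memNset ?mulr0// => -[].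
have ifm : mu.-integrable E (EFin \o fm m).
  apply: (@le_integrable _ _ _ mu E mE _ (EFin \o cst M)).
  - by apply/measurable_EFinP; exact: measurable_funTS (mfm m).
  - by move=> x _; rewrite /= lee_fin (ger0_norm M0).
  - apply/integrableP; split; first by apply/measurable_EFinP; exact: measurable_cst.
    by rewrite /= integral_cst// lte_mul_pinfty.
have [g_ [cg ig gE]] := approximation_continuous_integrable mE Efin ifm.
have [n _ /(_ n (leqnn n)) gn] : \forall n \near \oo,
    (\int[mu]_(z in E) `|(fm m z - g_ n z)%:E| <= (e / (4 * (2 * M + 1)))%:E)%E.
  have /cvge0P := gE; apply.
    by move=> k; apply: integral_ge0.
  by rewrite divr_gt0// mulr_gt0// ltr_wpDl// mulr_ge0.
pose c (x : R) := Num.max (- M) (Num.min M (g_ n x)).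
have cc : continuous c.
  move=> x; apply: (@continuous_max R R (cst (- M)) (fun x => Num.min M (g_ n x))).
    exact: cst_continuous.
  apply: (@continuous_min R R (cst M) (g_ n)); first exact: cst_continuous.
  exact: cg.
have cM x : `|c x| <= M by exact: clip_le.
have cg' x : `|fm m x - c x| <= `|fm m x - g_ n x| by exact/clip_dist/fmM.
pose phi (x : R) := c x * \1_E x.
have mc : measurable_fun setT c by exact: continuous_measurable_fun.
have mg : measurable_fun setT (g_ n) by apply: continuous_measurable_fun; exact: cg.
have mphi : measurable_fun setT phi by apply: measurable_funM => //; exact: measurable_indic.
have phiM x : `|phi x| <= M.
  by rewrite /phi normrM indicE; case: (_ \in _); rewrite ?normr1 ?mulr1// normr0 mulr0.
have phiE0 x : ~ E x -> phi x = 0 by move=> Ex; rewrite /phi indicE memNset// mulr0.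
have Nphi : (N2 (fun x : R => fm m x - phi x)%R <= (e / 4)%:E)%E.
  have -> : N2 (fun x : R => fm m x - phi x)%R =
      (\int[mu]_(x in E) ((fm m x - c x) ^+ 2)%:E)%E.
    rewrite [RHS]integral_mkcond; apply: eq_integral => x _; rewrite patchE.
    case: ifPn => [|/negP xE]; first by rewrite inE /phi => xE; rewrite indicE mem_set// mulr1.
    have Ex : ~ E x by move=> /mem_set.
    by rewrite fmE0// phiE0// subrr expr0n.
  apply: (@le_trans _ _ (\int[mu]_(x in E) ((2 * M)%:E * `|(fm m x - g_ n x)%:E|))%E).
    apply: ge0_le_integral => //=.
    - by move=> x _; rewrite lee_fin sqr_ge0.
    - apply: measurable_funTS; apply: mX; exact: measurable_funB.
    - apply: measurable_funTS; apply: measurable_funeM; apply/measurable_EFinP.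
      by apply: measurableT_comp => //; apply: measurable_funB; [exact: mfm|exact: mg].
    - move=> x _; rewrite -EFinM lee_fin -real_normK ?num_real// expr2 ler_pM//.
      by rewrite (le_trans (ler_normB _ _))// mulr_natl mulr2n lerD.
  rewrite ge0_integralZl//; last 2 first.
  - apply: measurable_funTS; apply/measurable_EFinP.
    by apply: measurableT_comp => //; apply: measurable_funB; [exact: mfm|exact: mg].
  - by rewrite lee_fin mulr_ge0.
  apply: (@le_trans _ _ ((2 * M)%:E * (e / (4 * (2 * M + 1)))%:E)%E).
    by rewrite lee_wpmul2l// lee_fin mulr_ge0.
  rewrite -EFinM lee_fin.
  have M1 : 0 < 2 * M + 1 by rewrite ltr_wpDl// mulr_ge0.
  have -> : 2 * M * (e / (4 * (2 * M + 1))) = e / 4 * (2 * M / (2 * M + 1)).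
    by field; rewrite gt_eqF.
  have : 2 * M / (2 * M + 1) <= 1 by rewrite ler_pdivrMr// mul1r lerDl.
  have : 0 < e / 4 by rewrite divr_gt0.
  nra.
exists phi; split => //.
  have -> : N2 (fun x : R => f x - phi x)%R =
      N2 (fun x : R => (f x - fm m x) + (fm m x - phi x))%R.
    by apply: eq_integral => x _; congr (_ ^+ 2)%:E; lra.
  have m1 : measurable_fun setT (fun x : R => f x - fm m x) by exact: measurable_funB.
  have m2 : measurable_fun setT (fun x : R => fm m x - phi x) by exact: measurable_funB.
  apply: (le_trans (integral_sqr_D mu m1 m2)).
  apply: (@le_trans _ _ (2%:E * ((e / 4)%:E + (e / 4)%:E))%E).
    by rewrite lee_pmul2l// leeD.
  rewrite -!(EFinD, EFinM) lee_fin; lra.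
have [H [_ hH]] : bounded_fun h.
  by apply: (@cvg_seq_bounded R R^o); apply/cvg_ex; exists 0.
pose K := `|H| + 1.
have hK k : `|h k| <= K by apply: hH => //; rewrite /K (le_lt_trans (ler_norm _))// ltrDl.
(* All the translates vanish outside [S], the shifts being bounded by [K]. *)
pose S : set R := `[- (M + K), M + K]%classic.
have mS : measurable S by exact: measurable_itv.
have Sfin : (mu S < +oo)%E by rewrite lebesgue_measure_itv/=; case: ifP => _; rewrite ?ltry// -EFinB ltry.
apply: (@cvg0_integral_dominated _ _ _ mu _ (fun x : R => (\1_S x)%:E) ((2 * M) ^+ 2)) => //.
- move=> k; apply: mX; apply: measurable_funB => //; exact: measurable_shift.
- by apply/measurable_EFinP; exact: measurable_indic.
- by move=> k x; rewrite lee_fin sqr_ge0.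
- by rewrite sqr_ge0.
- by rewrite integral_indic// setIT.
- move=> k x; rewrite -EFinM lee_fin indicE.
  case: (boolP (x \in S)) => [_|].
    rewrite mulr1 -real_normK ?num_real// ler_pXn2r ?nnegrE ?mulr_ge0//.
    by rewrite (le_trans (ler_normB _ _))// mulr_natl mulr2n lerD.
  move=> /negP xS; have {}xS : ~ S x by move=> /mem_set.
  have xMK : M + K < `|x|.
    by rewrite ltNge; apply/negP => xMK; apply: xS; rewrite /S/= in_itv/= -ler_norml.
  rewrite !phiE0 ?subrr ?expr0n ?mulr0//.
  + rewrite /E/= in_itv/= -ler_norml => xM.
    have := lerB_normD x (h k); have := hK k; have := normr_ge0 (h k); lra.
  + rewrite /E/= in_itv/= -ler_norml => xM.
    have := lerB_normD x (h k); have := hK k; lra.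
- have mu0 : mu [set - M; M] = 0%E.
    apply: countable_lebesgue_measure0; apply: finite_set_countable.
    exact: finite_set2.
  exists [set - M; M]; split => //; first exact: measurableU.
  move=> x /= xnot; apply: contrapT => xM; apply: xnot => _.
  have xM' : `|x| != M.
    apply/eqP => xM0; apply: xM; case: (ger0P x) xM0 => _ xM0; [right|left] => //.
    by rewrite -xM0 opprK.
  have EP y : E y <-> `|y| <= M by rewrite /E/= in_itv/= ler_norml.
  have nearE : \forall k \near \oo, \1_E (x + h k) = \1_E x :> R.
    apply: filterS (near_norm_le h0 xM') => k kE.
    rewrite !indicE; congr (_%:R); congr nat_of_bool.
    by apply/idP/idP; rewrite !inE !EP kE.
  have xh : (fun k => x + h k) @ \oo --> x.
    by rewrite -[X in _ --> X]addr0; apply: cvgD => //; exact: cvg_cst.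
  have cxh : (fun k => (c (x + h k) * \1_E x - phi x) ^+ 2) @ \oo --> 0.
    rewrite [X in _ --> X](_ : 0 = (c x * \1_E x - phi x) ^+ 2); last by rewrite subrr expr0n.
    apply: (@cvg_comp _ _ _ _ (fun y : R => y ^+ 2)); last exact: exprn_continuous.
    apply: cvgB; last exact: cvg_cst.
    apply: cvgM; last exact: cvg_cst.
    apply: (@cvg_comp _ _ _ (fun k => x + h k) c _ _ _ xh); exact: cc.
  apply: cvg_EFin; first exact: nearW.
  apply: cvg_trans cxh; apply: near_eq_cvg; near=> k.
  have -> : (c (x + h k) * \1_E x) = phi (x + h k).
    by rewrite /phi; congr (_ * _); apply/esym; near: k.
  by [].
Unshelve. all: by end_near. Qed.

End translation_1d.

Section translation_cV.
Context {R : realType}.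
Local Notation N2 n u := (\int[lebesgue_cV n]_x ((u x) ^+ 2)%:E)%E.

Lemma measurable_addv n (a : 'cV[R]_n) : measurable_fun setT (fun x : 'cV[R]_n => x + a).
Proof.
rewrite (_ : (fun _ => _) = (fun x : 'cV[R]_n => a + 1 *: x)); first exact: measurable_affine_cV.
by apply/funext => x; rewrite scale1r addrC.
Qed.

Lemma measurable_shift_cV n (f : 'cV[R]_n -> R) (a : 'cV[R]_n) :
  measurable_fun setT f -> measurable_fun setT (fun x : 'cV[R]_n => f (x + a)).
Proof. by move=> mf; exact: (measurableT_comp mf (measurable_addv a)). Qed.

Lemma ge0_integral_shift n (g : 'cV[R]_n -> \bar R) (a : 'cV[R]_n) :
  measurable_fun setT g -> (forall x, 0 <= g x)%E ->
  (\int[lebesgue_cV n]_x g (x + a)%R = \int[lebesgue_cV n]_x g x)%E.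
Proof.
move=> mg g0; have [_ _ /(_ g mg g0)] := transport_affine a (oner_neq0 R).
rewrite normr1 expr1n invr1 mul1e => <-.
by apply: eq_integral => x _; rewrite scale1r addrC.
Qed.

Lemma integral_sqr_shift_cV n (f : 'cV[R]_n -> R) (a : 'cV[R]_n) : measurable_fun setT f ->
  N2 n (fun x => f (x + a)) = N2 n f.
Proof.
move=> mf; rewrite (ge0_integral_shift (g := fun x => ((f x) ^+ 2)%:E))//.
  by apply/measurable_EFinP; exact: measurable_funX.
by move=> x; rewrite lee_fin sqr_ge0.
Qed.

Lemma shift_cons n t (x : 'cV[R]_n) (a : 'cV[R]_n.+1) :
  cons_cV (t, x) + a = cons_cV (t + (uncons_cV a).1, x + (uncons_cV a).2).
Proof.
have := affine_cons a 1 t x; rewrite !scale1r mul1r addrC => ->.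
by congr (cons_cV (_, _)); rewrite addrC.
Qed.

Local Notation mu := (@lebesgue_measure R).

Lemma integral_sqr_B d (T : measurableType d) (m : {measure set T -> \bar R}) (u v : T -> R) :
  measurable_fun setT u -> measurable_fun setT v ->
  (\int[m]_x ((u x - v x) ^+ 2)%:E <=
   2%:E * (\int[m]_x ((u x) ^+ 2)%:E + \int[m]_x ((v x) ^+ 2)%:E))%E.
Proof.
move=> mu mv; have := integral_sqr_D m mu (measurableT_comp (@oppr_measurable R setT) mv).
by under [X in (_ <= _ * (_ + X))%E]eq_integral do rewrite sqrrN.
Qed.

Lemma mule2D_le (x : \bar R) : (0 <= x -> 2%:E * (x + x) <= 4%:E * x)%E.
Proof.
case: x => [r| |] //; last by rewrite addey// gt0_muley ?lte_fin// gt0_muley ?lte_fin.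
by move=> _; rewrite -!(EFinD, EFinM) lee_fin; lra.
Qed.

Lemma cvge0_squeeze (u v w : nat -> \bar R) (c : R) : 0 < c ->
  (forall k, 0 <= u k)%E -> (forall k, 0 <= v k)%E -> (forall k, 0 <= w k)%E ->
  (forall k, u k <= c%:E * (v k + w k))%E ->
  v @ \oo --> 0%E -> w @ \oo --> 0%E -> u @ \oo --> 0%E.
Proof.
move=> c0 u0 v0 w0 uvw /cvge0P cv /cvge0P cw; apply/cvge0P => // e e0; near=> k.
rewrite (le_trans (uvw k))//.
apply: (@le_trans _ _ (c%:E * ((e / (2 * c))%:E + (e / (2 * c))%:E))%E).
  rewrite lee_pmul2l// leeD//; near: k.
    by apply: cv => //; rewrite divr_gt0// mulr_gt0.
  by apply: cw => //; rewrite divr_gt0// mulr_gt0.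
rewrite -!(EFinD, EFinM) lee_fin.
by rewrite (_ : c * _ = e)//; field; rewrite gt_eqF.
Unshelve. all: by end_near. Qed.

(** Induction on the dimension, translating the first coordinate and then the
others. Each of these two moves acts on slices; almost every slice is
square-integrable, so continuity holds on it, and dominated convergence
integrates over the slices. *)
Lemma L2_translation n (f : 'cV[R]_n -> R) (h : nat -> 'cV[R]_n) :
  measurable_fun setT f -> (N2 n f < +oo)%E ->
  (forall i, (fun k => h k i ord0) @ \oo --> 0) ->
  (fun k => N2 n (fun x => f (x + h k) - f x)) @ \oo --> 0%E.
Proof.
elim: n f h => [|n IH] f h mf foo h0.
  apply: cvg_near_cst; near=> k.
  rewrite integral0_eq// => x _.
  have -> : x + h k = x by apply/colP => -[].
  by rewrite subrr expr0n.
pose F t x := f (cons_cV (t, x)).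
pose a k := (uncons_cV (h k)).1; pose b k := (uncons_cV (h k)).2.
have a0 : a @ \oo --> 0 by exact: h0.
have b0 i : (fun k => b k i ord0) @ \oo --> 0.
  by under eq_fun do rewrite mxE; exact: h0.
have mF : measurable_fun setT (fun p => F p.1 p.2).
  rewrite (_ : (fun _ => _) = f \o @cons_cV R n).
    exact: (measurableT_comp mf (@measurable_cons_cV R n)).
  by apply/funext => -[].
have mFs (c : R) (v : 'cV[R]_n) : measurable_fun setT (fun p : R * 'cV[R]_n => F (p.1 + c) (p.2 + v)).
  apply: (measurableT_comp mF (_ : measurable_fun setT (fun p : R * 'cV[R]_n => (p.1 + c, p.2 + v)))).
  apply/measurable_fun_pairP; split => /=.
    exact: measurable_funD.
  exact: (measurableT_comp (measurable_addv v)).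
pose pi := (mu \x lebesgue_cV n)%E.
have NE (u : 'cV[R]_n.+1 -> R) : measurable_fun setT u ->
    N2 n.+1 u = (\int[pi]_p ((u (cons_cV p)) ^+ 2)%:E)%E.
  move=> mu'; have [_ _ /(_ (fun x => ((u x) ^+ 2)%:E))] := @transport_cons R n.
  rewrite mul1e => ->//; first by apply/measurable_EFinP; exact: measurable_funX.
  by move=> x; rewrite lee_fin sqr_ge0.
have T12 (g : R * 'cV[R]_n -> \bar R) : measurable_fun setT g -> (forall p, 0 <= g p)%E ->
    (\int[pi]_p g p = \int[mu]_t \int[lebesgue_cV n]_x g (t, x))%E.
  exact: (fubini_tonelli1 (m1 := mu) (m2 := lebesgue_cV n)).
have T21 (g : R * 'cV[R]_n -> \bar R) : measurable_fun setT g -> (forall p, 0 <= g p)%E ->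
    (\int[pi]_p g p = \int[lebesgue_cV n]_x \int[mu]_t g (t, x))%E.
  exact: (fubini_tonelli2 (m1 := mu) (m2 := lebesgue_cV n)).
pose U k p := F (p.1 + a k) (p.2 + b k) - F p.1 (p.2 + b k).
pose V k p := F p.1 (p.2 + b k) - F p.1 p.2.
have mFs0 (v : 'cV[R]_n) : measurable_fun setT (fun p : R * 'cV[R]_n => F p.1 (p.2 + v)).
  by have := mFs 0 v; under eq_fun do rewrite addr0.
have mU k : measurable_fun setT (U k) by exact: measurable_funB.
have mV k : measurable_fun setT (V k) by exact: measurable_funB.
have X0 d (T : measurableType d) (w : T -> R) x : (0 <= ((w x) ^+ 2)%:E)%E.
  by rewrite lee_fin sqr_ge0.
have mX d (T : measurableType d) (w : T -> R) : measurable_fun setT w ->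
    measurable_fun setT (fun x => ((w x) ^+ 2)%:E).
  by move=> mw; apply/measurable_EFinP; exact: measurable_funX.
have foo1 : (\int[lebesgue_cV n]_x \int[mu]_t ((F t x) ^+ 2)%:E < +oo)%E.
  move: foo; rewrite NE// (T21 (fun p => ((f (cons_cV p)) ^+ 2)%:E))//.
  by apply: mX; exact: (measurableT_comp mf (@measurable_cons_cV R n)).
have foo2 : (\int[mu]_t \int[lebesgue_cV n]_x ((F t x) ^+ 2)%:E < +oo)%E.
  move: foo; rewrite NE// (T12 (fun p => ((f (cons_cV p)) ^+ 2)%:E))//.
  by apply: mX; exact: (measurableT_comp mf (@measurable_cons_cV R n)).
have mF1 x : measurable_fun setT (F ^~ x) by exact: (measurableT_comp mF (measurable_pair2 x)).
have mF2 t : measurable_fun setT (F t) by exact: (measurableT_comp mF (measurable_pair1 t)).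
have cU : (fun k => \int[pi]_p ((U k p) ^+ 2)%:E)%E @ \oo --> 0%E.
  pose A k x := (\int[mu]_t ((F (t + a k) x - F t x) ^+ 2)%:E)%E.
  have mA k : measurable_fun setT (A k).
    apply: (measurable_fun_fubini_tonelli_G (m1 := mu)
      (fun p => ((F (p.1 + a k) p.2 - F p.1 p.2) ^+ 2)%:E)) => //.
      apply: mX; apply: measurable_funB => //.
      by have := mFs (a k) 0; under eq_fun do rewrite addr0.
    by move=> p; rewrite lee_fin sqr_ge0.
  have A0 k x : (0 <= A k x)%E by exact: integral_sqr_ge0.
  have UE k : (\int[pi]_p ((U k p) ^+ 2)%:E = \int[lebesgue_cV n]_x A k x)%E.
    apply: (etrans (T21 _ (mX _ _ _ (mU k)) (X0 _ _ (U k)))).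
    exact: (ge0_integral_shift (b k) (mA k) (A0 k)).
  under eq_fun do rewrite UE.
  apply: (@cvg0_integral_dominated _ _ _ _ _ (fun x => \int[mu]_t ((F t x) ^+ 2)%:E)%E 4) => //.
  - apply: (measurable_fun_fubini_tonelli_G (m1 := mu) (fun p => ((F p.1 p.2) ^+ 2)%:E)) => //.
    exact: mX.
  - by move=> x; exact: integral_sqr_ge0.
  - move=> k x; have := integral_sqr_B mu (measurable_shift (a k) (mF1 x)) (mF1 x).
    rewrite (integral_sqr_shift (a k) (mF1 x)) => /le_trans; apply.
    by apply: mule2D_le; exact: integral_sqr_ge0.
  - by apply: aeW => x Foo; exact: L2_translation_1d.
have cV : (fun k => \int[pi]_p ((V k p) ^+ 2)%:E)%E @ \oo --> 0%E.
  pose A k t := (\int[lebesgue_cV n]_x ((F t (x + b k)%R - F t x) ^+ 2)%:E)%E.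
  have mA k : measurable_fun setT (A k).
    apply: (measurable_fun_fubini_tonelli_F (m2 := lebesgue_cV n)
      (fun p => ((V k p) ^+ 2)%:E)) => //.
    exact: mX.
  have A0 k x : (0 <= A k x)%E by exact: integral_sqr_ge0.
  have VE k : (\int[pi]_p ((V k p) ^+ 2)%:E = \int[mu]_t A k t)%E.
    exact: (T12 _ (mX _ _ _ (mV k)) (X0 _ _ (V k))).
  under eq_fun do rewrite VE.
  apply: (@cvg0_integral_dominated _ _ _ mu _ (fun t => \int[lebesgue_cV n]_x ((F t x) ^+ 2)%:E)%E 4) => //.
  - apply: (measurable_fun_fubini_tonelli_F (m2 := lebesgue_cV n) (fun p => ((F p.1 p.2) ^+ 2)%:E)) => //.
    exact: mX.
  - by move=> x; exact: integral_sqr_ge0.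
  - move=> k t; have := integral_sqr_B (lebesgue_cV n) (measurable_shift_cV (b k) (mF2 t)) (mF2 t).
    rewrite (integral_sqr_shift_cV (b k) (mF2 t)) => /le_trans; apply.
    by apply: mule2D_le; exact: integral_sqr_ge0.
  - by apply: aeW => t Foo; exact: IH.
apply: (cvge0_squeeze (c := 2) _ _ _ _ _ cU cV) => //.
- by move=> k; exact: integral_sqr_ge0.
- by move=> k; exact: integral_sqr_ge0.
- by move=> k; exact: integral_sqr_ge0.
- move=> k; rewrite NE; last by apply: measurable_funB => //; exact: measurable_shift_cV.
  have -> : (\int[pi]_p ((f (cons_cV p + h k)%R - f (cons_cV p)) ^+ 2)%:E =
      \int[pi]_p ((U k p + V k p) ^+ 2)%:E)%E.
    apply: eq_integral => -[t x] _; congr (_ ^+ 2)%:E.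
    by rewrite shift_cons /U /V /F/=; lra.
  exact: (integral_sqr_D pi (mU k) (mV k)).
Unshelve. all: by end_near. Qed.

End translation_cV.

(** * The dot product *)

Section dot_product.
Context {R : realType}.

Lemma dotvC n (x y : 'cV[R]_n) : dotv x y = dotv y x.
Proof. by apply: eq_bigr => i _; rewrite mulrC. Qed.

Lemma dotvDl n (x y z : 'cV[R]_n) : dotv (x + y) z = dotv x z + dotv y z.
Proof. by rewrite -big_split; apply: eq_bigr => i _; rewrite !mxE mulrDl. Qed.

Lemma dotvZl n c (x z : 'cV[R]_n) : dotv (c *: x) z = c * dotv x z.
Proof. by rewrite mulr_sumr; apply: eq_bigr => i _; rewrite !mxE mulrA. Qed.

Lemma dotvDr n (x y z : 'cV[R]_n) : dotv z (x + y) = dotv z x + dotv z y.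
Proof. by rewrite dotvC dotvDl !(dotvC _ z). Qed.

Lemma dotvZr n c (x z : 'cV[R]_n) : dotv z (c *: x) = c * dotv z x.
Proof. by rewrite dotvC dotvZl !(dotvC _ z). Qed.

Lemma dotvNr n (x y : 'cV[R]_n) : dotv x (- y) = - dotv x y.
Proof. by rewrite -scaleN1r dotvZr mulN1r. Qed.

Lemma dotv0r n (x : 'cV[R]_n) : dotv x 0 = 0.
Proof. by rewrite /dotv big1// => i _; rewrite mxE mulr0. Qed.

Lemma dotv_ge0 n (x : 'cV[R]_n) : 0 <= dotv x x.
Proof. by apply: sumr_ge0 => i _; rewrite -expr2 sqr_ge0. Qed.

Lemma dotv_eq0 n (x : 'cV[R]_n) : dotv x x = 0 -> x = 0.
Proof.
move=> x0; apply/colP => i; rewrite mxE.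
have /(_ i isT)/eqP := psumr_eq0P (P := xpredT) (fun i _ => sqr_ge0 (x i ord0)) x0.
by rewrite mulf_eq0 orbb => /eqP.
Qed.

Lemma dotv_CS n (x y : 'cV[R]_n) : dotv x y ^+ 2 <= dotv x x * dotv y y.
Proof.
have [y0|y0] := eqVneq (dotv y y) 0.
  by rewrite (dotv_eq0 y0) dotv0r expr0n mulr_ge0// dotv_ge0.
have yp : 0 < dotv y y by rewrite lt_def y0 dotv_ge0.
have := dotv_ge0 (dotv y y *: x + (- dotv x y) *: y).
rewrite !dotvDl !dotvDr !dotvZl !dotvZr (dotvC y x).
set a := dotv x y; set b := dotv y y; set c := dotv x x.
have -> : b * (b * c) + b * (- a * a) + (- a * (b * a) + - a * (- a * b)) = b * (c * b - a ^+ 2) by ring.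
by rewrite pmulr_rge0// subr_ge0.
Qed.

Lemma measurable_dotv n (w : 'cV[R]_n) : measurable_fun setT (fun x => dotv x w).
Proof.
apply: measurable_sum => i; apply: measurable_funM => //.
exact: measurable_entry.
Qed.

Lemma measurable_dotv2 {n} : measurable_fun setT (fun p : 'cV[R]_n * 'cV[R]_n => dotv p.1 p.2).
Proof.
apply: measurable_sum => i; apply: measurable_funM.
  exact: (measurableT_comp (measurable_entry i ord0)).
exact: (measurableT_comp (measurable_entry i ord0)).
Qed.

Lemma dotv_cons n t s (x y : 'cV[R]_n) :
  dotv (cons_cV (t, x)) (cons_cV (s, y)) = t * s + dotv x y.
Proof.
rewrite /dotv big_ord_recl !cons_cV0; congr (_ + _).
by apply: eq_bigr => i _; rewrite !cons_cVS.
Qed.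

End dot_product.

(** * An explicit Fourier pair: exponential damping and the Lorentz kernel *)

Section fourier_1d.
Context {R : realType}.
Local Notation mu := (@lebesgue_measure R).

Lemma is_derive_expRN (x : R) : is_derive x 1 (fun x => expR (- x)) (- expR (- x)).
Proof.
have := @is_derive1_comp R expR (fun x => - x) x _ _ (is_derive_expR _) (is_deriveNid x 1).
by rewrite mulrN1.
Qed.

Lemma is_derive_sinM (w x : R) : is_derive x 1 (fun x => sin (w * x)) (w * cos (w * x)).
Proof.
have dw : is_derive x 1 (fun x => w * x) w.
  by have := is_deriveZ w (is_derive_id x (1 : R)); rewrite /GRing.scale/= mulr1.
have := @is_derive1_comp R sin (fun x => w * x) x _ _ (is_derive_sin _) dw.
by rewrite mulrC.
Qed.

Lemma is_derive_cosM (w x : R) : is_derive x 1 (fun x => cos (w * x)) (- (w * sin (w * x))).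
Proof.
have dw : is_derive x 1 (fun x => w * x) w.
  by have := is_deriveZ w (is_derive_id x (1 : R)); rewrite /GRing.scale/= mulr1.
have := @is_derive1_comp R cos (fun x => w * x) x _ _ (is_derive_cos _) dw.
by rewrite mulNr mulrC.
Qed.

(** Adding [1] to the cosine makes the integrand nonnegative, which is what the
improper fundamental theorem of calculus asks for. *)
Lemma integral_exp_cos (w : R) :
  (\int[mu]_x (expR (- `|x|) * (1 + cos (w * x)))%:E = (2 * (1 + (1 + w ^+ 2)^-1))%:E)%E.
Proof.
have w1 : 0 < 1 + w ^+ 2 by rewrite ltr_pwDl// sqr_ge0.
pose g x := expR (- x) * (1 + cos (w * x)).
pose F x := expR (- x) * ((w * sin (w * x) - cos (w * x)) / (1 + w ^+ 2) - 1).
have dF (x : R) : is_derive x 1 F (g x).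
  have ds := is_derive_sinM w x; have dc := is_derive_cosM w x; have de := is_derive_expRN x.
  apply: is_derive_eq.
  rewrite /GRing.scale/= /g; field; rewrite gt_eqF//.
have cF (x : R) : {for x, continuous F}.
  by apply: differentiable_continuous; apply/derivable1_diffP; apply: ex_derive.
have ccos : continuous (fun x : R => cos (w * x)).
  move=> x; apply: differentiable_continuous; apply/derivable1_diffP.
  by apply: ex_derive; exact: is_derive_cosM.
have cexp : continuous (fun x : R => expR (- x)).
  move=> x; apply: differentiable_continuous; apply/derivable1_diffP.
  by apply: ex_derive; exact: is_derive_expRN.
have cg : continuous g.
  move=> x; apply: cvgM; first exact: cexp.
  by apply: cvgD; [exact: cvg_cst|exact: ccos].
have g0 x : 0 <= g x.
  rewrite mulr_ge0 ?expR_ge0//; have := cos_geN1 (w * x); lra.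
have Fy : F x @[x --> +oo] --> 0.
  pose C := (`|w| + 1) / (1 + w ^+ 2) + 1.
  have Cy : C * expR (- x) @[x --> +oo] --> 0.
    by rewrite -(mulr0 C); apply: cvgM; [exact: cvg_cst|exact: cvgr_expR].
  apply: (@squeeze_cvgr _ _ _ _ (fun x => - (C * expR (- x))) (fun x => C * expR (- x))) => //; last first.
    by rewrite -oppr0; exact: cvgN.
  apply: nearW => x; rewrite -ler_norml normrM ger0_norm ?expR_ge0// mulrC.
  rewrite ler_wpM2r ?expR_ge0// (le_trans (ler_normB _ _))// normr1 lerD2r.
  rewrite normrM normfV (gtr0_norm w1) ler_wpM2r ?invr_ge0 ?(ltW w1)//.
  rewrite (le_trans (ler_normB _ _))// lerD//.
    rewrite normrM ler_piMr// ler_norml; apply/andP; split.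
      exact: sin_geN1.
    exact: sin_le1.
  rewrite ler_norml; apply/andP; split; [exact: cos_geN1|exact: cos_le1].
have evenE x : expR (- `|x|) * (1 + cos (w * x)) = expR (- `|- x|) * (1 + cos (w * - x)).
  by rewrite normrN mulrN cosN.
rewrite (@ge0_symfun_integralT R (fun x => expR (- `|x|) * (1 + cos (w * x)))).
- rewrite -set_itvcy.
  have -> : (\int[mu]_(x in `[0%R, +oo[) (expR (- `|x|) * (1 + cos (w * x)))%:E =
      \int[mu]_(x in `[0%R, +oo[) (g x)%:E)%E.
    apply: eq_integral.
    by move=> x; rewrite inE/= in_itv/= andbT => x0; rewrite /g ger0_norm.
  rewrite (@ge0_continuous_FTC2y R g F 0 0) => //.
  + rewrite /F oppr0 expR0 mulr0 sin0 cos0 mulr0 -EFinB -EFinM; congr EFin.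
    by field; rewrite gt_eqF.
  + exact: continuous_subspaceT.
  + by apply: cvg_at_right_filter; exact: cF.
  + by move=> x _; rewrite derive1E; exact: derive_val.
- move=> x; rewrite mulr_ge0 ?expR_ge0//; have := cos_geN1 (w * x); lra.
- move=> x; apply: cvgM.
    apply: (@cvg_comp _ _ _ (fun x : R => `|x|) (fun y => expR (- y))); last exact: cexp.
    exact: norm_continuous.
  by apply: cvgD; [exact: cvg_cst|exact: ccos].
- exact: evenE.
Qed.

Definition abs_exp (x : R) : R := expR (- `|x|).

(** The Fourier transform of [abs_exp]: a Cauchy density of scale
[1 / (2 pi)]. *)
Definition lorentz (y : R) : R := 2 / (1 + (2 * pi * y) ^+ 2).

Lemma abs_exp_ge0 x : 0 <= abs_exp x.
Proof. exact: expR_ge0. Qed.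

Lemma abs_exp_le1 x : abs_exp x <= 1.
Proof. by rewrite /abs_exp -expR0 ler_expR oppr_le0. Qed.

Lemma continuous_abs_exp : continuous abs_exp.
Proof.
move=> x; apply: (@cvg_comp _ _ _ (fun x : R => - `|x|) expR); last exact: continuous_expR.
by apply: cvgN; exact: norm_continuous.
Qed.

Lemma measurable_abs_exp : measurable_fun setT abs_exp.
Proof. by apply: continuous_measurable_fun; exact: continuous_abs_exp. Qed.

Lemma integral_abs_exp : (\int[mu]_x (abs_exp x)%:E = 2%:E)%E.
Proof.
have := integral_exp_cos 0; rewrite expr0n/= addr0 invr1 mulrC.
under eq_integral do rewrite mul0r cos0 EFinM.
rewrite ge0_integralZr//; last by apply/measurable_EFinP; exact: measurable_abs_exp.
rewrite -/(abs_exp _); case: (integral _ _ _) => [r| |].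
- by rewrite -EFinM => -[] rE; congr EFin; lra.
- by rewrite gt0_mulye// lte_fin addr_gt0.
- by rewrite gt0_mulNye// lte_fin addr_gt0.
Qed.

Lemma integrable_abs_exp : mu.-integrable setT (EFin \o abs_exp).
Proof.
apply/integrableP; split; first by apply/measurable_EFinP; exact: measurable_abs_exp.
under eq_integral do rewrite /= ger0_norm ?abs_exp_ge0//.
by rewrite integral_abs_exp ltry.
Qed.

Lemma Cintegrable_abs_exp (w : R) :
  Cintegrable mu (fun x => (abs_exp x)%:C * expi (w * x)).
Proof.
apply: (Cintegrable_le _ integrable_abs_exp).
  apply: CmeasurableM; first by apply: Cmeasurable_real; exact: measurable_abs_exp.
  by apply: Cmeasurable_expi; exact: measurable_funM.
by move=> x; rewrite Normc.normcM normc_expi mulr1 normc_real ger0_norm ?abs_exp_ge0.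
Qed.

(** The real part is [integral_exp_cos]; the imaginary part is the integral of an
odd function. *)
Lemma fourier_abs_exp (y : R) :
  Cintegral mu (fun x => (abs_exp x)%:C * expi (2 * pi * y * x)) = (lorentz y)%:C.
Proof.
set w := 2 * pi * y.
have [iR iI] := Cintegrable_abs_exp w.
apply: complex_ext => /=.
  have ic : mu.-integrable setT (EFin \o (fun x => abs_exp x * cos (w * x))).
    by apply: eq_integrable iR => // x _; rewrite /= mul0r subr0.
  transitivity (\int[mu]_x (abs_exp x * cos (w * x))).
    by apply: eq_Rintegral => x _; rewrite mul0r subr0.
  have : \int[mu]_x (abs_exp x + abs_exp x * cos (w * x)) = 2 * (1 + (1 + w ^+ 2)^-1).
    rewrite -[RHS]/(fine (2 * (1 + (1 + w ^+ 2)^-1))%:E) -integral_exp_cos; congr fine.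
    by apply: eq_integral => x _; rewrite mulrDr mulr1.
  rewrite RintegralD//; last exact: integrable_abs_exp.
  have -> : \int[mu]_x abs_exp x = 2 by rewrite /Rintegral integral_abs_exp.
  rewrite /lorentz -/w; lra.
set I := (X in X = _).
suff : I = - I by lra.
rewrite {1}/I; have := @transport_lebesgue_affine R 0 (-1).
rewrite oppr_eq0 oner_neq0 normrN1 invr1 => /(_ isT) tr.
have := transport_Rintegral tr iI; rewrite mul1r => <-.
transitivity (\int[mu]_x (-1 * complex.Im ((abs_exp x)%:C * expi (w * x)))).
  apply: eq_Rintegral => x _ /=.
  have -> : 0 + -1 * x = - x :> R by rewrite add0r mulN1r.
  by rewrite /abs_exp normrN mulrN sinN; lra.
by rewrite RintegralZl// mulN1r.
Qed.

Lemma lorentz_ge0 y : 0 <= lorentz y.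
Proof. by rewrite /lorentz divr_ge0// addr_ge0// sqr_ge0. Qed.

Lemma continuous_lorentz : continuous lorentz.
Proof.
move=> y; apply: cvgM; first exact: cvg_cst.
apply: cvgV; first by rewrite gt_eqF// ltr_pwDl// sqr_ge0.
apply: cvgD; first exact: cvg_cst.
apply: (@cvg_comp _ _ _ (fun y : R => 2 * pi * y) (fun y => y ^+ 2)); last exact: exprn_continuous.
by apply: cvgM; [exact: cvg_cst|exact: cvg_id].
Qed.

Lemma measurable_lorentz : measurable_fun setT lorentz.
Proof. by apply: continuous_measurable_fun; exact: continuous_lorentz. Qed.

Lemma integral_lorentz : (\int[mu]_x (lorentz x)%:E = 1)%E.
Proof.
have p0 : (2 * pi : R) != 0 by rewrite gt_eqF// mulr_gt0// pi_gt0.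
have [_ _ tr] := transport_lebesgue_affine 0 p0.
pose g (x : R) := 2 / (1 + x ^+ 2).
have cg : continuous g.
  move=> y; apply: cvgM; first exact: cvg_cst.
  apply: cvgV; first by rewrite gt_eqF// ltr_pwDl// sqr_ge0.
  by apply: cvgD; [exact: cvg_cst|exact: exprn_continuous].
have g0 x : 0 <= g x by rewrite divr_ge0// addr_ge0// sqr_ge0.
have mg : measurable_fun setT (fun x : R => (g x)%:E).
  by apply/measurable_EFinP; exact: continuous_measurable_fun.
have := tr (fun x => (g x)%:E) mg (fun x => g0 x).
under eq_integral do rewrite add0r.
rewrite -/(lorentz _) => ->.
rewrite (@ge0_symfun_integralT R g)//; last by move=> x; rewrite /g/= sqrrN.
rewrite -set_itvcy.
under eq_integral do rewrite /g EFinM.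
have oE (x : R) : 1 + x ^+ 2 = oneDsqr x by [].
rewrite ge0_integralZl//; last 2 first.
- apply/measurable_EFinP; apply: measurable_funTS; apply: continuous_measurable_fun.
  exact: continuous_oneDsqrV.
- by move=> x _; rewrite lee_fin invr_ge0 addr_ge0// sqr_ge0.
rewrite integral0y_oneDsqr -!EFinM; congr EFin.
have pi0 : (pi : R) != 0 by exact: lt0r_neq0 (pi_gt0 R).
have pp : 0 < 2 * pi :> R by rewrite mulr_gt0// pi_gt0.
by rewrite (gtr0_norm pp); move: (pi : R) pi0 => q q0; field.
Qed.

End fourier_1d.

Section tensor_powers.
Context {R : realType}.
Local Notation mu := (@lebesgue_measure R).

(** Products of functions of one variable: their integrals and Fourier transforms
reduce to dimension one. *)
Definition tensor n (p : R -> R) (x : 'cV[R]_n) : R := \prod_(i < n) p (x i ord0).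

Lemma tensor_cons n p t (x : 'cV[R]_n) : tensor p (cons_cV (t, x)) = p t * tensor p x.
Proof.
rewrite /tensor big_ord_recl cons_cV0/=; congr (_ * _).
by apply: eq_bigr => i _; rewrite cons_cVS.
Qed.

Lemma measurable_tensor n (p : R -> R) : measurable_fun setT p ->
  measurable_fun setT (@tensor n p).
Proof.
move=> mp; apply: measurable_prod => i _.
by apply: (measurableT_comp mp); exact: measurable_entry.
Qed.

Lemma tensor_ge0 n p (x : 'cV[R]_n) : (forall t, 0 <= p t) -> 0 <= tensor p x.
Proof. by move=> p0; apply: prodr_ge0. Qed.

Lemma integral_tensor n (p : R -> R) (c : R) : measurable_fun setT p -> (forall t, 0 <= p t) ->
  (\int[mu]_t (p t)%:E = c%:E)%E ->
  (\int[lebesgue_cV n]_x (tensor p x)%:E = (c ^+ n)%:E)%E.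
Proof.
move=> mp p0 pc; elim: n => [|n IH].
  rewrite integral_dirac//; last first.
    by apply/measurable_EFinP; exact: measurable_tensor.
  by rewrite diracT mul1e /tensor big_ord0.
rewrite ge0_integral_cons; last 2 first.
- by apply/measurable_EFinP; exact: measurable_tensor.
- by move=> x; rewrite lee_fin tensor_ge0.
under eq_integral => t _.
  under eq_integral do rewrite tensor_cons EFinM.
  rewrite ge0_integralZl ?lee_fin//; last 2 first.
  - by apply/measurable_EFinP; exact: measurable_tensor.
  - by move=> x _; rewrite lee_fin tensor_ge0.
  rewrite IH.
  over.
rewrite /= ge0_integralZr//; last 3 first.
- by apply/measurable_EFinP.
- by move=> t _; rewrite lee_fin.
- by rewrite -IH; apply: integral_ge0 => x _; rewrite lee_fin tensor_ge0.
by rewrite pc -EFinM exprS.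
Qed.

Lemma integrable_tensor n (p : R -> R) (c : R) : measurable_fun setT p -> (forall t, 0 <= p t) ->
  (\int[mu]_t (p t)%:E = c%:E)%E ->
  (lebesgue_cV n).-integrable setT (EFin \o @tensor n p).
Proof.
move=> mp p0 pc; apply/integrableP; split.
  by apply/measurable_EFinP; exact: measurable_tensor.
under eq_integral do rewrite /= ger0_norm ?tensor_ge0//.
by rewrite (integral_tensor n mp p0 pc) ltry.
Qed.

Lemma cons_unconsK n (z : 'cV[R]_n.+1) : cons_cV (uncons_cV z) = z.
Proof.
apply/colP => i; case: (unliftP ord0 i) => [k ->|->].
  by rewrite cons_cVS mxE.
by rewrite cons_cV0.
Qed.

Lemma Cmeasurable_tensor_exp n (w : 'cV[R]_n) (c : R) :
  Cmeasurable (fun x => (tensor abs_exp x)%:C * expi (c * dotv x w)).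
Proof.
apply: CmeasurableM.
  by apply: Cmeasurable_real; apply: measurable_tensor; exact: measurable_abs_exp.
by apply: Cmeasurable_expi; apply: measurable_funM => //; exact: measurable_dotv.
Qed.

Lemma Cintegrable_tensor_exp n (w : 'cV[R]_n) (c : R) :
  Cintegrable (lebesgue_cV n) (fun x => (tensor abs_exp x)%:C * expi (c * dotv x w)).
Proof.
apply: (Cintegrable_le _ (integrable_tensor n measurable_abs_exp (@abs_exp_ge0 R) integral_abs_exp)).
  exact: Cmeasurable_tensor_exp.
move=> x; rewrite Normc.normcM normc_expi mulr1 normc_real ger0_norm//.
by apply: tensor_ge0; exact: abs_exp_ge0.
Qed.

Lemma fourier_tensor n (w : 'cV[R]_n) :
  Cintegral (lebesgue_cV n) (fun x => (tensor abs_exp x)%:C * expi (2 * pi * dotv x w)) =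
  (tensor lorentz w)%:C.
Proof.
elim: n w => [|n IH] w.
  have mF := Cmeasurable_tensor_exp w (2 * pi).
  have E (g : 'cV[R]_0 -> R) : measurable_fun setT g -> \int[lebesgue_cV 0]_x g x = g 0.
    move=> mg; rewrite /Rintegral/= integral_dirac//; last exact/measurable_EFinP.
    by rewrite diracT mul1e.
  rewrite /Cintegral !E; [|exact: mF.2|exact: mF.1].
  rewrite /tensor /dotv !big_ord0 mulr0 expi0 mulr1; exact: complex_ext.
have := transport_Cintegral (@transport_cons R n) (Cintegrable_tensor_exp w (2 * pi)).
rewrite mul1r => <-.
pose G1 (t : R) := (abs_exp t)%:C * expi (2 * pi * (uncons_cV w).1 * t).
pose G2 x := (tensor abs_exp x)%:C * expi (2 * pi * dotv x (uncons_cV w).2).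
transitivity (Cintegral (mu \x lebesgue_cV n)%E (fun p => G1 p.1 * G2 p.2)).
  apply: eq_Cintegral => -[t x] /=.
  rewrite -[w in LHS]cons_unconsK [uncons_cV w]surjective_pairing dotv_cons tensor_cons.
  rewrite mulrDr expiD rmorphM/= mulrACA; congr (_ * _); congr (_ * expi _).
  by rewrite (mulrC t) mulrA.
transitivity (Cintegral mu G1 * Cintegral (lebesgue_cV n) G2).
  apply: (Cintegral_prodfun (m1 := mu) (m2 := lebesgue_cV n)).
    exact: Cintegrable_abs_exp.
  exact: Cintegrable_tensor_exp.
rewrite fourier_abs_exp IH -rmorphM/=; congr (_%:C).
by rewrite -[w in RHS]cons_unconsK [uncons_cV w]surjective_pairing tensor_cons.
Qed.

End tensor_powers.

Section regularization.
Context {R : realType} {n : nat}.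
Local Notation mu := (@lebesgue_cV R n).

Lemma tensor_abs_expE (e : R) (xi : 'cV[R]_n) : 0 <= e ->
  tensor abs_exp (e *: xi) = expR (- (e * \sum_i `|xi i ord0|)).
Proof.
move=> e0; rewrite mulr_sumr -sumrN expR_sum; apply: eq_bigr => i _.
by rewrite /abs_exp mxE normrM (ger0_norm e0).
Qed.

Lemma tensor_abs_exp_le1 (xi : 'cV[R]_n) : tensor abs_exp xi <= 1.
Proof. rewrite /tensor -[leRHS](expr1n R n) -[X in _ ^+ X]card_ord -prodr_const.
by apply: ler_prod => i _; rewrite abs_exp_ge0 abs_exp_le1. Qed.

Lemma lorentz_le2 (y : R) : lorentz y <= 2.
Proof.
have h : 1 <= 1 + (2 * pi * y) ^+ 2 by rewrite lerDl sqr_ge0.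
by rewrite /lorentz ler_pdivrMr ?(lt_le_trans _ h)// ler_peMr.
Qed.

Lemma tensor_lorentz_le (y : 'cV[R]_n) : tensor lorentz y <= 2 ^+ n.
Proof.
rewrite /tensor -[X in _ ^+ X]card_ord -prodr_const; apply: ler_prod => i _.
by rewrite lorentz_ge0 lorentz_le2.
Qed.

Lemma tensor_lorentz_ge0 (y : 'cV[R]_n) : 0 <= tensor lorentz y.
Proof. by apply: tensor_ge0; exact: lorentz_ge0. Qed.

Lemma measurable_tensor_lorentz : measurable_fun setT (@tensor R n lorentz).
Proof. by apply: measurable_tensor; exact: measurable_lorentz. Qed.

Lemma integral_tensor_lorentz : (\int[mu]_u (tensor lorentz u)%:E = 1)%E.
Proof.
by rewrite (integral_tensor n measurable_lorentz (@lorentz_ge0 R) integral_lorentz) expr1n.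
Qed.

Lemma integrable_tensor_lorentz : mu.-integrable setT (EFin \o @tensor R n lorentz).
Proof. exact: (integrable_tensor n measurable_lorentz (@lorentz_ge0 R) integral_lorentz). Qed.

Lemma measurable_scale (e : R) : measurable_fun setT (fun xi : 'cV[R]_n => e *: xi).
Proof.
rewrite (_ : (fun _ => _) = (fun x : 'cV[R]_n => 0 + e *: x)); first exact: measurable_affine_cV.
by apply/funext => x; rewrite add0r.
Qed.

Lemma measurable_tensor_scale (e : R) :
  measurable_fun setT (fun xi : 'cV[R]_n => tensor abs_exp (e *: xi)).
Proof.
apply: (measurableT_comp (measurable_tensor measurable_abs_exp)); exact: measurable_scale.
Qed.

Lemma Cintegrable_tensor_scale (e : R) : e != 0 ->
  Cintegrable mu (fun xi : 'cV[R]_n => (tensor abs_exp (e *: xi))%:C).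
Proof.
move=> e0; have := transport_Cintegrable (transport_affine 0 e0) (Cintegrable_tensor_exp (0 : 'cV[R]_n) 0).
by under [X in Cintegrable _ X]eq_fun do rewrite mul0r expi0 mulr1 add0r.
Qed.

Lemma fourier_tensor_scale (e : R) (w : 'cV[R]_n) : 0 < e ->
  Cintegral mu (fun xi => (tensor abs_exp (e *: xi))%:C * expi (2 * pi * dotv xi w)) =
  (e ^- n)%:C * (tensor lorentz (e^-1 *: w))%:C.
Proof.
move=> e0; have e1 : e != 0 by rewrite gt_eqF.
have := transport_Cintegral (transport_affine 0 e1) (Cintegrable_tensor_exp (e^-1 *: w) (2 * pi)).
rewrite fourier_tensor (gtr0_norm e0) => <-; apply: eq_Cintegral => xi.
by rewrite add0r dotvZl dotvZr mulrA mulrA mulfK// mulrAC.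
Qed.

End regularization.

(** * Fourier inversion for the Wigner function *)

Section lag_product.
Context {R : realType} {n : nat}.
Variable f : 'cV[R]_n -> R[i].
Hypothesis mf : Cmeasurable f.
Local Notation mu := (@lebesgue_cV R n).
Local Notation nsq x := (Normc.normc (f x) ^+ 2).
Hypothesis f1 : (\int[mu]_x (nsq x)%:E = 1)%E.

Let mnsq : measurable_fun setT (fun x => nsq x).
Proof. by apply: measurable_funX; exact: measurable_normc. Qed.

Let insq : mu.-integrable setT (EFin \o (fun x => nsq x)).
Proof.
apply/integrableP; split; first exact/measurable_EFinP.
under eq_integral do rewrite /= ger0_norm ?sqr_ge0//.
by rewrite f1 ltry.
Qed.

Definition lag x y : R[i] := f (x + 2^-1 *: y) * (f (x - 2^-1 *: y))^*.

Lemma measurable_addZ c : measurable_fun setT (fun p : 'cV[R]_n * 'cV[R]_n => p.1 + c *: p.2).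
Proof.
apply: measurable_fun_matrixP => i j.
rewrite (_ : (fun _ => _) = (fun p : 'cV[R]_n * 'cV[R]_n => p.1 i j + c * p.2 i j)).
  apply: measurable_funD.
    by apply: (measurableT_comp (measurable_entry i j)).
  by apply: measurable_funM => //; exact: (measurableT_comp (measurable_entry i j)).
by apply/funext => x; rewrite !mxE.
Qed.

Lemma lagE x y : lag x y = f (x + 2^-1 *: y) * (f (x + (- 2^-1) *: y))^*.
Proof. by rewrite /lag scaleNr. Qed.

Lemma Cmeasurable_lag : Cmeasurable (fun p => lag p.1 p.2).
Proof.
rewrite (_ : (fun p => _) = (fun p => f (p.1 + 2^-1 *: p.2) * (f (p.1 + (- 2^-1) *: p.2))^*)).
  apply: CmeasurableM.
    exact: (Cmeasurable_comp mf (measurable_addZ _)).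
  apply: Cmeasurable_conj; exact: (Cmeasurable_comp mf (measurable_addZ _)).
by apply/funext => p; rewrite lagE.
Qed.

Definition lag_bound x y : R := (nsq (x + 2^-1 *: y) + nsq (x + (- 2^-1) *: y)) / 2.

Lemma lag_le x y : Normc.normc (lag x y) <= lag_bound x y.
Proof.
rewrite lagE Normc.normcM normc_conjc /lag_bound.
set a := Normc.normc _; set b := Normc.normc _.
by have := sqr_ge0 (a - b); rewrite sqrrB; lra.
Qed.

Lemma lag_bound_integrable_y x : mu.-integrable setT (EFin \o lag_bound x).
Proof.
have h0 : (2^-1 : R) != 0 by rewrite invr_eq0.
have i1 := transport_integrable (transport_affine x h0) insq.
have h1 : (- 2^-1 : R) != 0 by rewrite oppr_eq0.
have i2 := transport_integrable (transport_affine x h1) insq.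
exact: (integrableZr measurableT 2^-1 (integrableD measurableT i1 i2)).
Qed.

Lemma measurable_lag_bound y : measurable_fun setT (lag_bound ^~ y).
Proof.
apply: measurable_funM => //; apply: measurable_funD.
  exact: (measurableT_comp mnsq (measurable_addv _)).
exact: (measurableT_comp mnsq (measurable_addv _)).
Qed.

(** By translation invariance, each half of [lag_bound] contributes half of the
squared norm of [f], whatever [y]. *)
Lemma integral_lag_bound y : (\int[mu]_x (lag_bound x y)%:E = 1)%E.
Proof.
under eq_integral do rewrite /lag_bound EFinM EFinD.
rewrite ge0_integralZr//; last 2 first.
- by apply: emeasurable_funD; apply/measurable_EFinP;
    exact: (measurableT_comp mnsq (measurable_addv _)).
- by move=> x _; rewrite adde_ge0// lee_fin sqr_ge0.
rewrite ge0_integralD//; last 4 first.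
- by move=> x _; rewrite lee_fin sqr_ge0.
- by apply/measurable_EFinP; exact: (measurableT_comp mnsq (measurable_addv _)).
- by move=> x _; rewrite lee_fin sqr_ge0.
- by apply/measurable_EFinP; exact: (measurableT_comp mnsq (measurable_addv _)).
rewrite !(ge0_integral_shift (g := fun x => (nsq x)%:E))//; last 4 first.
- exact/measurable_EFinP.
- by move=> x; rewrite lee_fin sqr_ge0.
- exact/measurable_EFinP.
- by move=> x; rewrite lee_fin sqr_ge0.
by rewrite f1 -EFinD -EFinM; congr EFin; lra.
Qed.

Lemma Cintegrable_lag_y x : Cintegrable mu (lag x).
Proof.
apply: (Cintegrable_le _ (lag_bound_integrable_y x)) => [|y]; last exact: lag_le.
exact: (Cmeasurable_comp Cmeasurable_lag (measurable_pair1 x)).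
Qed.

Lemma Cintegrable_lag_x y : Cintegrable mu (lag ^~ y).
Proof.
have : mu.-integrable setT (EFin \o (lag_bound ^~ y)).
  apply/integrableP; split; first by apply/measurable_EFinP; exact: measurable_lag_bound.
  under eq_integral do rewrite /= ger0_norm ?(le_trans (normc_ge0 _) (lag_le _ _))//.
  by rewrite integral_lag_bound ltry.
move=> /Cintegrable_le; apply=> [|x]; last exact: lag_le.
exact: (Cmeasurable_comp Cmeasurable_lag (measurable_pair2 y)).
Qed.

Lemma normc_translation (h : nat -> 'cV[R]_n) :
  (forall i, (fun k => h k i ord0) @ \oo --> 0) ->
  (fun k => \int[mu]_x ((Normc.normc (f (x + h k) - f x)) ^+ 2)%:E)%E @ \oo --> 0%E.
Proof.
move=> h0; have [mR mI] := mf.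
have part (u : 'cV[R]_n -> R) : measurable_fun setT u ->
    (forall x, `|u x| <= Normc.normc (f x)) -> (\int[mu]_x ((u x) ^+ 2)%:E < +oo)%E.
  move=> mu' uf; apply: le_lt_trans (_ : (\int[mu]_x (nsq x)%:E < +oo)%E); last by rewrite f1 ltry.
  apply: integral_sqr_le => //; first exact: measurable_normc.
  by move=> x; rewrite (ger0_norm (normc_ge0 _)).
have cR := L2_translation mR (part _ mR (fun x => normr_Re_le _)) h0.
have cI := L2_translation mI (part _ mI (fun x => normr_Im_le _)) h0.
have mX (w : 'cV[R]_n -> R) : measurable_fun setT w ->
    measurable_fun setT (fun x => ((w x) ^+ 2)%:E).
  by move=> mw; apply/measurable_EFinP; exact: measurable_funX.
apply: (cvge0_squeeze (c := 1) _ _ _ _ _ cR cI) => //.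
- by move=> k; exact: integral_sqr_ge0.
- by move=> k; exact: integral_sqr_ge0.
- by move=> k; exact: integral_sqr_ge0.
move=> k; rewrite mul1e -ge0_integralD//; last 4 first.
- by move=> x _; rewrite lee_fin sqr_ge0.
- by apply: mX; apply: measurable_funB => //; exact: (measurable_shift_cV _ mR).
- by move=> x _; rewrite lee_fin sqr_ge0.
- by apply: mX; apply: measurable_funB => //; exact: (measurable_shift_cV _ mI).
rewrite le_eqVlt; apply/orP; left; apply/eqP; apply: eq_integral => x _.
by rewrite normc_sqr ReD ImD ReN ImN.
Qed.

(** The ambiguity function of [f], which [wigner_inversion] identifies with the
two-sided Fourier transform of its Wigner function. *)
Definition corr (b : 'cV[R]_n) y : R[i] :=
  Cintegral mu (fun x => expi (2 * pi * dotv x b) * lag x y).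

Lemma Cmeasurable_char (b : 'cV[R]_n) : Cmeasurable (fun x => expi (2 * pi * dotv x b)).
Proof.
by apply: Cmeasurable_expi; apply: measurable_funM => //; exact: measurable_dotv.
Qed.

Lemma Cintegrable_corr b y : Cintegrable mu (fun x => expi (2 * pi * dotv x b) * lag x y).
Proof.
under [X in Cintegrable _ X]eq_fun do rewrite mulrC.
apply: Cintegrable_bounded; first exact: Cintegrable_lag_x.
  exact: Cmeasurable_char.
by move=> t; rewrite normc_expi.
Qed.

Lemma normc_corr_le b y : Normc.normc (corr b y) <= 2.
Proof.
rewrite -[2]mulr1; apply: (normc_Cintegral_le (Cintegrable_corr b y) (measurable_lag_bound y)).
  by move=> x; rewrite Normc.normcM normc_expi mul1r lag_le.
by rewrite integral_lag_bound.
Qed.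

Lemma Cmeasurable_corr b : Cmeasurable (corr b).
Proof.
apply: (@Cmeasurable_fubini _ _ _ _ _ mu (fun p => expi (2 * pi * dotv p.2 b) * lag p.2 p.1)).
apply: CmeasurableM; first exact: (Cmeasurable_comp (Cmeasurable_char b)).
have sw : measurable_fun setT (fun p : 'cV[R]_n * 'cV[R]_n => (p.2, p.1)) by exact: measurable_fun_pair.
exact: (Cmeasurable_comp Cmeasurable_lag sw).
Qed.

(** Writing [u v* - u' v'* = (u - u') v* + u' (v - v')*], each term is the product
of a difference of translates of [f], small in [L^2], and a translate of norm
one. *)
Lemma corr_continuous b (y : nat -> 'cV[R]_n) (a : 'cV[R]_n) :
  (forall i, (fun k => (y k - a) i ord0) @ \oo --> 0) ->
  Ccvg (fun k => corr b (y k)) (corr b a).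
Proof.
move=> ya.
pose P (c : R) k x := Normc.normc (f (x + c *: y k) - f (x + c *: a)).
pose Q (z : 'cV[R]_n) x := Normc.normc (f (x + z)).
have mQ z : measurable_fun setT (Q z).
  by apply: measurable_normc; exact: (Cmeasurable_comp mf (measurable_addv _)).
have mP c k : measurable_fun setT (P c k).
  apply: measurable_normc.
  under [X in Cmeasurable X]eq_fun do rewrite -mulN1r.
  apply: CmeasurableD; first exact: (Cmeasurable_comp mf (measurable_addv _)).
  apply: CmeasurableM; first exact: Cmeasurable_cst.
  exact: (Cmeasurable_comp mf (measurable_addv _)).
have NQ z : (\int[mu]_x ((Q z x) ^+ 2)%:E <= 1%:E)%E.
  by rewrite (integral_sqr_shift_cV z (measurable_normc mf)) f1.
have cP c : (fun k => \int[mu]_x ((P c k x) ^+ 2)%:E)%E @ \oo --> 0%E.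
  have h0 i : (fun k => (c *: (y k - a)) i ord0) @ \oo --> 0.
    under eq_fun do rewrite mxE.
    by rewrite -(mulr0 c); apply: cvgM; [exact: cvg_cst|exact: ya].
  apply: cvg_trans (normc_translation h0); apply: near_eq_cvg; apply: nearW => k /=.
  pose g x := ((Normc.normc (f (x + c *: (y k - a)) - f x)) ^+ 2)%:E.
  rewrite -(@ge0_integral_shift R n g (c *: a)).
  - apply: eq_integral => x _; rewrite /g /P; congr (_ ^+ 2)%:E; congr (Normc.normc (f _ - _)).
    by rewrite scalerBr addrAC addrA subrK.
  - apply/measurable_EFinP; apply: measurable_funX; apply: measurable_normc.
    under [X in Cmeasurable X]eq_fun do rewrite -mulN1r.
    apply: CmeasurableD; first exact: (Cmeasurable_comp mf (measurable_addv _)).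
    by apply: CmeasurableM => //; exact: Cmeasurable_cst.
  - by move=> x; rewrite lee_fin sqr_ge0.
pose g k x := P 2^-1 k x * Q (- 2^-1 *: y k) x + P (- 2^-1) k x * Q (2^-1 *: a) x.
have P0 c k x : 0 <= P c k x by exact: normc_ge0.
have Q0 z x : 0 <= Q z x by exact: normc_ge0.
have mg k : measurable_fun setT (g k).
  by apply: measurable_funD; exact: measurable_funM.
apply: (@Cintegral_L1cvg _ _ _ mu _ _ g) => //.
- by move=> k; exact: Cintegrable_corr.
- exact: Cintegrable_corr.
- move=> k x; rewrite -mulrBr Normc.normcM normc_expi mul1r !lagE.
  set u := f (x + 2^-1 *: y k); set v := f (x + _ *: y k).
  set u' := f (x + 2^-1 *: a); set v' := f (x + _ *: a).
  have -> : u * v^* - u' * v'^* = (u - u') * v^* + u' * (v - v')^*.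
    by rewrite rmorphB/= mulrBl mulrBr addrA subrK.
  rewrite (le_trans (le_normcD _ _))// !Normc.normcM !normc_conjc /g lerD//.
  by rewrite mulrC.
- have c1 := cvg0_integralM (mP 2^-1) (fun k => mQ (- 2^-1 *: y k)) (P0 _) (fun k => Q0 _)
    (cP _) (fun k => NQ _).
  have c2 := cvg0_integralM (mP (- 2^-1)) (fun k => mQ (2^-1 *: a)) (P0 _) (fun k => Q0 _)
    (cP _) (fun k => NQ _).
  have I0 (u v : 'cV[R]_n -> R) : (forall x, 0 <= u x) -> (forall x, 0 <= v x) ->
    (0 <= \int[mu]_x (u x * v x)%:E)%E.
    by move=> u0 v0; apply: integral_ge0 => x _; rewrite lee_fin mulr_ge0.
  apply: (cvge0_squeeze (c := 1) _ _ _ _ _ c1 c2) => //.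
  + move=> k; apply: integral_ge0 => x _; rewrite lee_fin addr_ge0 ?mulr_ge0//.
  + by move=> k; exact: I0.
  + by move=> k; exact: I0.
  move=> k; rewrite mul1e -ge0_integralD//.
  + by move=> x _; rewrite lee_fin mulr_ge0.
  + by apply/measurable_EFinP; exact: measurable_funM.
  + by move=> x _; rewrite lee_fin mulr_ge0.
  + by apply/measurable_EFinP; exact: measurable_funM.
Qed.

End lag_product.

Section wigner_inversion.
Context {R : realType} {n : nat}.
Variable f : 'cV[R]_n -> R[i].
Hypothesis mf : Cmeasurable f.
Local Notation mu := (@lebesgue_cV R n).
Hypothesis f1 : (\int[mu]_x (Normc.normc (f x) ^+ 2)%:E = 1)%E.
Local Notation char x b := (expi (2 * pi * dotv x b)).

Lemma wignerE x xi :
  wigner f x xi = Cintegral mu (fun y => lag f x y * expi (- (2 * pi * dotv xi y))).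
Proof. by []. Qed.

Lemma Cmeasurable_wigner2 : Cmeasurable (fun p => wigner f p.1 p.2).
Proof.
apply: (@Cmeasurable_fubini _ _ _ _ _ mu
  (fun q => lag f q.1.1 q.2 * expi (- (2 * pi * dotv q.1.2 q.2)))).
apply: CmeasurableM.
  have sw : measurable_fun setT (fun q : 'cV[R]_n * 'cV[R]_n * 'cV[R]_n => (q.1.1, q.2)).
    by apply: measurable_fun_pair => //; exact: measurableT_comp.
  exact: (Cmeasurable_comp (Cmeasurable_lag mf) sw).
apply: Cmeasurable_expi; apply: measurableT_comp => //; apply: measurable_funM => //.
have sw : measurable_fun setT (fun q : 'cV[R]_n * 'cV[R]_n * 'cV[R]_n => (q.1.2, q.2)).
  by apply: measurable_fun_pair => //; exact: measurableT_comp.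
exact: (measurableT_comp measurable_dotv2 sw).
Qed.

Lemma measurable_usubmx : measurable_fun setT (fun z : 'cV[R]_(n + n) => usubmx z).
Proof.
apply: measurable_fun_matrixP => i j; under eq_fun do rewrite mxE.
exact: measurable_entry.
Qed.

Lemma measurable_dsubmx : measurable_fun setT (fun z : 'cV[R]_(n + n) => dsubmx z).
Proof.
apply: measurable_fun_matrixP => i j; under eq_fun do rewrite mxE.
exact: measurable_entry.
Qed.

Lemma Cmeasurable_Wigner : Cmeasurable (Wigner f).
Proof.
have sw : measurable_fun setT (fun z : 'cV[R]_(n + n) => (usubmx z, dsubmx z)).
  apply: measurable_fun_pair; [exact: measurable_usubmx|exact: measurable_dsubmx].
exact: (Cmeasurable_comp Cmeasurable_wigner2 sw).
Qed.

Lemma Wigner_col x xi : Wigner f (col_mx x xi) = wigner f x xi.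
Proof. by rewrite /Wigner col_mxKu col_mxKd. Qed.

(** Fubini on one slice: integrating the Wigner function against a damped
character undoes the Fourier transform up to the Lorentz kernel. *)
Lemma wigner_slice (x a : 'cV[R]_n) (c : R[i]) (e : R) : 0 < e ->
  Cintegral mu (fun xi => wigner f x xi *
    (c * ((tensor abs_exp (e *: xi))%:C * char xi a))) =
  c * Cintegral mu (fun u => lag f x (a + (- e) *: u) * (tensor lorentz u)%:C).
Proof.
move=> e0; have e1 : e != 0 by rewrite gt_eqF.
pose F (p : 'cV[R]_n * 'cV[R]_n) : R[i] := c *
  ((tensor abs_exp (e *: p.1))%:C * lag f x p.2 * char p.1 (a - p.2)).
have mchar : Cmeasurable (fun p : 'cV[R]_n * 'cV[R]_n => char p.1 (a - p.2)).
  apply: Cmeasurable_expi; apply: measurable_funM => //.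
  have sw : measurable_fun setT (fun q : 'cV[R]_n * 'cV[R]_n => (q.1, a - q.2)).
    apply: measurable_fun_pair => //.
    under eq_fun do rewrite -scaleN1r.
    exact: (measurableT_comp (measurable_affine_cV _ _)).
  exact: (measurableT_comp measurable_dotv2 sw).
have iF : Cintegrable (mu \x mu)%E F.
  apply: CintegrableZ; apply: Cintegrable_bounded => //.
    exact: (Cintegrable_prodfun (Cintegrable_tensor_scale e1) (Cintegrable_lag_y mf f1 x)).
  by move=> p; rewrite normc_expi.
transitivity (Cintegral mu (fun xi => Cintegral mu (fun y => F (xi, y)))).
  apply: eq_Cintegral => xi; rewrite wignerE mulrC -CintegralZ.
    apply: eq_Cintegral => y; rewrite /F /=.
    have -> : 2 * pi * dotv xi (a - y) = 2 * pi * dotv xi a + - (2 * pi * dotv xi y).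
      by rewrite dotvDr dotvNr mulrBr.
    by rewrite expiD; ring.
  apply: Cintegrable_bounded; first exact: Cintegrable_lag_y.
    apply: Cmeasurable_expi; apply: measurableT_comp => //; apply: measurable_funM => //.
    rewrite (_ : dotv xi = fun y => dotv y xi); first exact: measurable_dotv.
    by apply/funext => y; rewrite dotvC.
  by move=> y; rewrite normc_expi.
rewrite Cintegral_swap//.
pose H y := lag f x y * (tensor lorentz (e^-1 *: (a - y)))%:C.
have iH : Cintegrable mu H.
  apply: (@Cintegrable_bound _ _ _ _ _ _ (2 ^+ n)); first exact: Cintegrable_lag_y.
    apply: Cmeasurable_real; apply: (measurableT_comp measurable_tensor_lorentz).
    apply: (measurableT_comp (measurable_scale _)).
    under eq_fun do rewrite -scaleN1r.
    exact: measurable_affine_cV.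
  by move=> y; rewrite normc_real ger0_norm ?tensor_lorentz_ge0// tensor_lorentz_le.
transitivity (Cintegral mu (fun y => (c * (e ^- n)%:C) * H y)).
  apply: eq_Cintegral => y.
  transitivity (Cintegral mu (fun xi => (c * lag f x y) *
      ((tensor abs_exp (e *: xi))%:C * char xi (a - y)))).
    by apply: eq_Cintegral => xi; rewrite /F/=; ring.
  rewrite CintegralZ; last first.
    apply: Cintegrable_bounded; [exact: Cintegrable_tensor_scale| |by move=> ?; rewrite normc_expi].
    exact: Cmeasurable_char.
  by rewrite fourier_tensor_scale// /H; ring.
rewrite CintegralZ//.
have me1 : - e != 0 by rewrite oppr_eq0.
have := transport_Cintegral (transport_affine a me1) iH.
rewrite normrN (gtr0_norm e0) -mulrA => <-; congr (_ * _).
apply: eq_Cintegral => u; rewrite /H; congr (_ * (tensor lorentz _)%:C).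
by rewrite opprD addrA subrr add0r scaleNr opprK scalerA mulVf// scale1r.
Qed.

(** The damping makes Fubini applicable in the frequency, and the Lorentz weights
produced by [wigner_slice] make it applicable in the position: for each [u] the
integral of [lag_bound] in [x] is [1]. *)
Lemma wigner_regularized (a b : 'cV[R]_n) (e : R) : 0 < e ->
  Cintegrable (lebesgue_cV (n + n)) (Wigner f) ->
  Cintegral (lebesgue_cV (n + n)) (fun z => Wigner f z *
    (char (usubmx z) b * ((tensor abs_exp (e *: dsubmx z))%:C * char (dsubmx z) a))) =
  Cintegral mu (fun u => (tensor lorentz u)%:C * corr f b (a + (- e) *: u)).
Proof.
move=> e0 iW; have e1 : e != 0 by rewrite gt_eqF.
set Phi := fun z => _.
have iPhi : Cintegrable (lebesgue_cV (n + n)) Phi.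
  apply: Cintegrable_bounded => //.
    apply: CmeasurableM.
      exact: (Cmeasurable_comp (Cmeasurable_char b) measurable_usubmx).
    apply: CmeasurableM.
      apply: Cmeasurable_real.
      exact: (measurableT_comp (measurable_tensor_scale e) measurable_dsubmx).
    exact: (Cmeasurable_comp (Cmeasurable_char a) measurable_dsubmx).
  move=> z; rewrite !Normc.normcM !normc_expi mul1r mulr1 normc_real ger0_norm ?tensor_abs_exp_le1//.
  by apply: tensor_ge0; exact: abs_exp_ge0.
have tr := @transport_col_mx R n n.
have := transport_Cintegral tr iPhi; rewrite mul1r => <-.
rewrite Cintegral_fubini12; last exact: (transport_Cintegrable tr iPhi).
pose F (p : 'cV[R]_n * 'cV[R]_n) :=
  char p.1 b * (lag f p.1 (a + (- e) *: p.2) * (tensor lorentz p.2)%:C).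
have mF : Cmeasurable F.
  apply: CmeasurableM; first exact: (Cmeasurable_comp (Cmeasurable_char b)).
  apply: CmeasurableM.
    have sw : measurable_fun setT (fun q : 'cV[R]_n * 'cV[R]_n => (q.1, a + (- e) *: q.2)).
      apply: measurable_fun_pair => //.
      exact: (measurableT_comp (measurable_affine_cV _ _)).
    exact: (Cmeasurable_comp (Cmeasurable_lag mf) sw).
  by apply: Cmeasurable_real; exact: (measurableT_comp measurable_tensor_lorentz).
have iF : Cintegrable (mu \x mu)%E F.
  apply: Cintegrable_tonelli21 => //.
  apply: (@le_lt_trans _ _ (\int[mu]_u (tensor lorentz u)%:E)%E); last first.
    by rewrite integral_tensor_lorentz ltry.
  have mF' : measurable_fun setT (fun p => (Normc.normc (F p))%:E).
    by apply/measurable_EFinP; exact: measurable_normc.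
  apply: ge0_le_integral => //.
  - by move=> u _; apply: integral_ge0 => x _; rewrite lee_fin normc_ge0.
  - apply: (measurable_fun_fubini_tonelli_G (m1 := mu) (fun p => (Normc.normc (F p))%:E)) => // p.
    by rewrite lee_fin normc_ge0.
  - by apply/measurable_EFinP; exact: measurable_tensor_lorentz.
  move=> u _; rewrite -[leRHS]mule1 -(integral_lag_bound mf f1 (a + (- e) *: u)).
  have mb := measurable_lag_bound mf (a + (- e) *: u).
  rewrite -ge0_integralZl ?lee_fin ?tensor_lorentz_ge0//; last 2 first.
  - exact/measurable_EFinP.
  - by move=> x _; rewrite lee_fin (le_trans (normc_ge0 _) (lag_le _ _ _)).
  apply: ge0_le_integral => //.
  - by move=> x _; rewrite lee_fin normc_ge0.
  - exact: (measurableT_comp mF' (measurable_pair2 u)).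
  - by apply: measurable_funeM; exact/measurable_EFinP.
  - move=> x _; rewrite -EFinM lee_fin /F/= Normc.normcM normc_expi mul1r Normc.normcM.
    rewrite normc_real ger0_norm ?tensor_lorentz_ge0// mulrC.
    by rewrite ler_wpM2l ?tensor_lorentz_ge0 ?lag_le.
transitivity (Cintegral mu (fun x => Cintegral mu (fun u => F (x, u)))).
  apply: eq_Cintegral => x.
  transitivity (Cintegral mu (fun xi => wigner f x xi *
      (char x b * ((tensor abs_exp (e *: xi))%:C * char xi a)))).
    by apply: eq_Cintegral => xi; rewrite /Phi/= Wigner_col col_mxKu col_mxKd.
  rewrite wigner_slice// -CintegralZ//.
  apply: (@Cintegrable_bound _ _ _ _ _ _ (2 ^+ n)).
  - have me1 : - e != 0 by rewrite oppr_eq0.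
    exact: (transport_Cintegrable (transport_affine a me1) (Cintegrable_lag_y mf f1 x)).
  - by apply: Cmeasurable_real; exact: measurable_tensor_lorentz.
  - by move=> y; rewrite normc_real ger0_norm ?tensor_lorentz_ge0// tensor_lorentz_le.
rewrite Cintegral_swap//; apply: eq_Cintegral => u.
rewrite -CintegralZ; last exact: Cintegrable_corr.
by apply: eq_Cintegral => x; rewrite /F/=; ring.
Qed.

Lemma cvg_harmonic_scale (s : R) : (fun k : nat => k.+1%:R^-1 * s) @ \oo --> 0.
Proof. by rewrite -(mul0r s); apply: cvgM; [exact: cvg_harmonic|exact: cvg_cst]. Qed.

(** The damping [e] tends to [0] in [wigner_regularized]. *)
Theorem wigner_inversion (a b : 'cV[R]_n) :
  Cintegrable (lebesgue_cV (n + n)) (Wigner f) ->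
  Cintegral (lebesgue_cV (n + n)) (fun z => Wigner f z *
    (char (usubmx z) b * char (dsubmx z) a)) = corr f b a.
Proof.
move=> iW; pose e (k : nat) : R := k.+1%:R^-1.
have e0 k : 0 < e k by rewrite invr_gt0 ltr0n.
pose L (u : 'cV[R]_n) := (tensor lorentz u)%:C.
have mL : Cmeasurable L by apply: Cmeasurable_real; exact: measurable_tensor_lorentz.
have iL : Cintegrable mu L.
  apply: (Cintegrable_le mL integrable_tensor_lorentz) => u.
  by rewrite normc_real ger0_norm ?tensor_lorentz_ge0.
have L1 : Cintegral mu L = 1.
  apply: complex_ext => /=; first by rewrite /Rintegral integral_tensor_lorentz.
  by rewrite /Rintegral integral0.
have mcharu : Cmeasurable (fun z : 'cV[R]_(n + n) => char (usubmx z) b).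
  exact: (Cmeasurable_comp (Cmeasurable_char b) measurable_usubmx).
have mchard : Cmeasurable (fun z : 'cV[R]_(n + n) => char (dsubmx z) a).
  exact: (Cmeasurable_comp (Cmeasurable_char a) measurable_dsubmx).
have lim1 : Ccvg (fun k => Cintegral mu (fun u => L u * corr f b (a + (- e k) *: u)))
    (corr f b a).
  have -> : corr f b a = Cintegral mu (fun u => L u * corr f b a).
    under eq_Cintegral do rewrite mulrC.
    by rewrite CintegralZ// L1 mulr1.
  have ig : mu.-integrable setT (EFin \o (fun u => tensor lorentz u * 2)).
    exact: (integrableZr measurableT 2 (@integrable_tensor_lorentz R n)).
  apply: (Cintegral_dct (F_ := fun k u => L u * corr f b (a + (- e k) *: u)) _ _ _ ig).
  - move=> k; apply: CmeasurableM => //.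
    exact: (Cmeasurable_comp (Cmeasurable_corr mf b) (measurable_affine_cV _ _)).
  - by apply: CmeasurableM => //; exact: Cmeasurable_cst.
  - move=> u; apply: CcvgM; first exact: Ccvg_cst.
    apply: corr_continuous => // i.
    under eq_fun do rewrite addrAC subrr add0r mxE.
    under eq_fun do rewrite mulNr.
    by rewrite -oppr0; apply: cvgN; exact: cvg_harmonic_scale.
  - move=> k u; rewrite Normc.normcM normc_real ger0_norm ?tensor_lorentz_ge0//.
    by rewrite ler_wpM2l ?tensor_lorentz_ge0// normc_corr_le.
apply: Ccvg_unique lim1.
under [X in Ccvg X _]eq_fun do rewrite /L -(wigner_regularized _ _ (e0 _) iW).
apply: (Cintegral_dct (F_ := fun k z => Wigner f z * (char (usubmx z) b *
  ((tensor abs_exp (e k *: dsubmx z))%:C * char (dsubmx z) a))) _ _ _ (Cintegrable_normc iW)).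
- move=> k; apply: CmeasurableM; first exact: Cmeasurable_Wigner.
  apply: CmeasurableM => //; apply: CmeasurableM => //.
  apply: Cmeasurable_real.
  exact: (measurableT_comp (measurable_tensor_scale _) measurable_dsubmx).
- apply: CmeasurableM; first exact: Cmeasurable_Wigner.
  exact: CmeasurableM.
- move=> z; apply: CcvgM; first exact: Ccvg_cst.
  apply: CcvgM; first exact: Ccvg_cst.
  rewrite -[X in Ccvg _ X]mul1r; apply: CcvgM; last exact: Ccvg_cst.
  have H : (fun k => expR (- (e k * \sum_i `|dsubmx z i ord0|))) @ \oo --> (1 : R).
    rewrite -[X in _ --> X]expR0.
    apply: (@cvg_comp _ _ _ _ expR); last exact: continuous_expR.
    by rewrite -oppr0; apply: cvgN; exact: cvg_harmonic_scale.
  split => /=; last exact: cvg_cst.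
  by under eq_fun do rewrite (tensor_abs_expE _ (ltW (e0 _))).
- move=> k z; rewrite Normc.normcM ler_piMr ?normc_ge0// !Normc.normcM !normc_expi mul1r mulr1.
  by rewrite normc_real ger0_norm ?tensor_abs_exp_le1//; apply: tensor_ge0; exact: abs_exp_ge0.
Qed.

End wigner_inversion.

(** * Positivity of twisted sums against the Wigner function *)

Section quantum_bochner.
Context {R : realType} {n : nat}.
Variable f : 'cV[R]_n -> R[i].
Hypothesis mf : Cmeasurable f.
Local Notation mu := (@lebesgue_cV R n).
Hypothesis f1 : (\int[mu]_x (Normc.normc (f x) ^+ 2)%:E = 1)%E.
Local Notation char x b := (expi (2 * pi * dotv x b)).
Implicit Types p q z : 'cV[R]_(n + n).

(** The phase-space translate of [f] by [p = col_mx b a], with frequency shift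
[b] and position shift [a]. *)
Definition weyl p x : R[i] :=
  expi (2 * pi * dotv x (usubmx p) + pi * dotv (dsubmx p) (usubmx p)) * f (x + dsubmx p).

(** The standard symplectic form, opposite to that of [symplJ]
([symplJ_form]). *)
Definition sigma p q : R := dotv (dsubmx p) (usubmx q) - dotv (dsubmx q) (usubmx p).

Lemma Cmeasurable_weyl p : Cmeasurable (weyl p).
Proof.
apply: CmeasurableM; last exact: (Cmeasurable_comp mf (measurable_addv _)).
apply: Cmeasurable_expi; apply: measurable_funD => //.
by apply: measurable_funM => //; exact: measurable_dotv.
Qed.

Let insq a : mu.-integrable setT (EFin \o (fun x => Normc.normc (f (x + a)) ^+ 2)).
Proof.
apply/integrableP; split.
  apply/measurable_EFinP; apply: measurable_funX; apply: measurable_normc.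
  exact: (Cmeasurable_comp mf (measurable_addv _)).
under eq_integral do rewrite /= ger0_norm ?sqr_ge0//.
by rewrite (integral_sqr_shift_cV a (measurable_normc mf)) f1 ltry.
Qed.

Lemma Cintegrable_weyl p q : Cintegrable mu (fun x => weyl p x * (weyl q x)^*).
Proof.
have i2 := integrableD measurableT (insq (dsubmx p)) (insq (dsubmx q)).
apply: (Cintegrable_le _ i2).
  by apply: CmeasurableM; [|apply: Cmeasurable_conj]; exact: Cmeasurable_weyl.
move=> x; rewrite Normc.normcM normc_conjc !Normc.normcM !normc_expi !mul1r /=.
set u := Normc.normc _; set v := Normc.normc _.
have u0 : 0 <= u by exact: normc_ge0.
have v0 : 0 <= v by exact: normc_ge0.
by have := sqr_ge0 (u - v); rewrite sqrrB; nra.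
Qed.

(** The overlap of two translates depends on their difference only, up to the
phase of the Heisenberg group. *)
Lemma weyl_inner p q :
  Cintegral mu (fun x => weyl p x * (weyl q x)^*) =
  expi (pi * sigma p q) * corr f (usubmx (p - q)) (dsubmx (p - q)).
Proof.
set a1 := dsubmx p; set a2 := dsubmx q; set b1 := usubmx p; set b2 := usubmx q.
have -> : dsubmx (p - q) = a1 - a2 by apply/colP => i; rewrite !mxE.
have -> : usubmx (p - q) = b1 - b2 by apply/colP => i; rewrite !mxE.
pose s := 2^-1 *: (a1 + a2).
have iK := Cintegrable_corr mf f1 (b1 - b2) (a1 - a2).
have tr := transport_affine s (oner_neq0 R).
have := transport_Cintegral tr iK; rewrite normr1 expr1n invr1 mul1r /corr => <-.
rewrite -CintegralZ; last exact: (transport_Cintegrable tr iK).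
apply: eq_Cintegral => x; rewrite /weyl -/a1 -/a2 -/b1 -/b2 scale1r lagE.
have -> : s + x + 2^-1 *: (a1 - a2) = x + a1.
  by apply/colP => i; rewrite !mxE; field.
have -> : s + x + (- 2^-1) *: (a1 - a2) = x + a2.
  by apply/colP => i; rewrite !mxE; field.
rewrite rmorphM/= conj_expi.
transitivity (expi (2 * pi * dotv x b1 + pi * dotv a1 b1) *
   expi (- (2 * pi * dotv x b2 + pi * dotv a2 b2)) * (f (x + a1) * (f (x + a2))^*)).
  by ring.
rewrite [RHS]mulrA -!expiD; congr (expi _ * _).
rewrite /sigma -/a1 -/a2 -/b1 -/b2 dotvDl dotvZl !dotvDl !dotvDr !dotvNr; by field.
Qed.

(** The integral is the squared norm of [\sum_j c_j (weyl p_j)]: the overlaps of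
its terms are values of [corr] by [weyl_inner], hence integrals against the
Wigner function by [wigner_inversion]. *)
Lemma quantum_bochner (s : seq (R[i] * 'cV[R]_(n + n))) :
  Cintegrable (lebesgue_cV (n + n)) (Wigner f) ->
  0 <= complex.Re (Cintegral (lebesgue_cV (n + n)) (fun z => Wigner f z *
    \sum_(j <- s) \sum_(k <- s) j.1 * k.1^* *
      expi (pi * sigma j.2 k.2 + 2 * pi * dotv z (j.2 - k.2)))).
Proof.
move=> iW.
pose Q x := \sum_(j <- s) j.1 * weyl j.2 x.
pose G j k z := j.1 * k.1^* * expi (pi * sigma j.2 k.2 + 2 * pi * dotv z (j.2 - k.2)) : R[i].
have iWG (j k : R[i] * 'cV[R]_(n + n)) :
    Cintegrable (lebesgue_cV (n + n)) (fun z => Wigner f z * G j k z).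
  apply: (@Cintegrable_bound _ _ _ _ _ _ (Normc.normc (j.1 * k.1^*))) => //.
    apply: CmeasurableM; first exact: Cmeasurable_cst.
    apply: Cmeasurable_expi; apply: measurable_funD => //.
    by apply: measurable_funM => //; exact: measurable_dotv.
  by move=> z; rewrite Normc.normcM normc_expi mulr1.
have GE j k : Cintegral (lebesgue_cV (n + n)) (fun z => Wigner f z * G j k z) =
    Cintegral mu (fun x => j.1 * k.1^* * (weyl j.2 x * (weyl k.2 x)^*)).
  rewrite CintegralZ; last exact: Cintegrable_weyl.
  rewrite weyl_inner -(wigner_inversion mf f1 _ _ iW) mulrA -CintegralZ; last first.
    apply: Cintegrable_bounded => //.
      apply: CmeasurableM.
        exact: (Cmeasurable_comp (Cmeasurable_char _) measurable_usubmx).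
      exact: (Cmeasurable_comp (Cmeasurable_char _) measurable_dsubmx).
    by move=> z; rewrite Normc.normcM !normc_expi mul1r.
  apply: eq_Cintegral => z; rewrite /G.
  have -> : dotv z (j.2 - k.2) = dotv (usubmx z) (usubmx (j.2 - k.2)) +
      dotv (dsubmx z) (dsubmx (j.2 - k.2)).
    rewrite /dotv big_split_ord/=; congr (_ + _); apply: eq_bigr => i _;
    by rewrite !mxE.
  by rewrite (mulrDr (2 * pi)) !expiD; ring.
suff -> : Cintegral (lebesgue_cV (n + n)) (fun z => Wigner f z *
    \sum_(j <- s) \sum_(k <- s) G j k z) = Cintegral mu (fun x => Q x * (Q x)^*).
  apply: Rintegral_ge0 => x _; rewrite ReM Re_conjc Im_conjc.
  have := sqr_ge0 (complex.Re (Q x)); have := sqr_ge0 (complex.Im (Q x)); rewrite !expr2; lra.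
under eq_Cintegral do (rewrite mulr_sumr; under eq_bigr do rewrite mulr_sumr).
rewrite Cintegral_sum; last by move=> j; apply: Cintegrable_sum => k.
have QE x : Q x * (Q x)^* =
    \sum_(j <- s) \sum_(k <- s) j.1 * k.1^* * (weyl j.2 x * (weyl k.2 x)^*).
  rewrite /Q rmorph_sum/= big_distrlr/=; apply: eq_bigr => j _; apply: eq_bigr => k _.
  by rewrite rmorphM/= mulrACA.
under [in RHS]eq_Cintegral do rewrite QE.
have iw (j k : R[i] * 'cV[R]_(n + n)) :
    Cintegrable mu (fun x => j.1 * k.1^* * (weyl j.2 x * (weyl k.2 x)^*)).
  by apply: CintegrableZ; exact: Cintegrable_weyl.
rewrite Cintegral_sum; last by move=> j; apply: Cintegrable_sum => k.
apply: eq_bigr => j _; rewrite !Cintegral_sum//.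
by apply: eq_bigr => k _; exact: GE.
Qed.

End quantum_bochner.

(** * The second-order expansion at the origin *)

Section trig.
Context {R : realType}.
Implicit Types s x y : R.

Lemma normr_sin_le x : `|sin x| <= `|x|.
Proof.
wlog x0 : x / 0 <= x.
  by move=> H; case: (leP 0 x) => x0; [exact: H|rewrite -normrN -sinN -(normrN x) H// oppr_ge0 ltW].
have [|c _] := MVT_segment x0 (fun c _ => is_derive_sin c).
  by apply: continuous_subspaceT; exact: continuous_sin.
rewrite sin0 !subr0 => ->.
by rewrite normrM ler_piMl// cos_max.
Qed.

Lemma cos_half x : cos x = 1 - 2 * sin (x / 2) ^+ 2.
Proof.
rewrite [in LHS](splitr x) cosD -expr2 cos2sin2 -expr2; lra.
Qed.

(** The real part of the twisted sum of [quantum_bochner] for the points [0], [p],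
[q] with coefficients [-(1 + i)], [1], [i], where [s] is the phase of the pair
[(p, q)] and [x], [y] are the phases of [p] and [q] at the point of integration. *)
Definition theta s x y : R :=
  4 - 2 * cos x - 2 * sin x - 2 * cos y + 2 * sin y + 2 * sin (s + x - y).

(** In half-angle form every term is of second order, when [x] and [y] count for
one and [s] for two. *)
Lemma thetaE s x y : theta s x y =
  4 * sin (x / 2) ^+ 2 + 4 * sin (y / 2) ^+ 2 +
  2 * (sin s * cos (x - y) - 2 * sin (s / 2) ^+ 2 * sin (x - y)
       - 2 * sin (y / 2) ^+ 2 * sin x + 2 * sin (x / 2) ^+ 2 * sin y).
Proof.
rewrite /theta -[s + x - y]addrA (sinD s) (cos_half s) sinB (cos_half x) (cos_half y); ring.
Qed.

Lemma theta_le s x y : `|theta s x y| <= 2 * (x ^+ 2 + y ^+ 2) + 4 * `|s|.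
Proof.
have S (z : R) : sin (z / 2) ^+ 2 <= z ^+ 2 / 4.
  have := normr_sin_le (z / 2); rewrite -(ler_pXn2r (n := 2)) ?nnegrE// !real_normK ?num_real//.
  by rewrite expr_div_n; lra.
have S1 (z : R) : 2 * sin (z / 2) ^+ 2 <= `|z|.
  have h1 := normr_sin_le (z / 2); have h2 := sin_max (z / 2).
  rewrite -real_normK ?num_real// expr2.
  have : `|z / 2| = `|z| / 2 by rewrite normrM normfV (ger0_norm (ler0n R 2)).
  have := normr_ge0 (sin (z / 2)); nra.
have H1 : `|sin s * cos (x - y)| <= `|s|.
  by rewrite normrM (le_trans _ (normr_sin_le s))// ler_piMr// cos_max.
have H2 (a b : R) : 0 <= a -> `|2 * a * sin b| <= 2 * a.
  by move=> a0; rewrite normrM ger0_norm ?mulr_ge0// ler_piMr ?mulr_ge0// sin_max.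
have A0 (z : R) : 0 <= sin (z / 2) ^+ 2 by exact: sqr_ge0.
have := H2 _ (x - y) (A0 s); have := H2 _ x (A0 y); have := H2 _ y (A0 x).
have := S x; have := S y; have := S1 s; have := A0 x; have := A0 y; move: H1.
rewrite thetaE !ler_norml => /andP[? ?] ? ? ? ? ? /andP[? ?] /andP[? ?] /andP[? ?].
by apply/andP; split; lra.
Qed.

Lemma cvg_sinV (h : nat -> R) (c : R) : (forall k, h k != 0) -> h @ \oo --> 0 ->
  (fun k => sin (c * h k) / h k) @ \oo --> c.
Proof.
move=> h0 ch; have := is_derive_sinM c 0; rewrite mulr0 cos0 mulr1.
move=> /is_derive1_caratheodory[g [gE cg g0]].
rewrite -[X in _ --> X]g0.
have -> : (fun k => sin (c * h k) / h k) = (fun k => g (h k)).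
  apply/funext => k; have := gE (h k); rewrite mulr0 sin0 !subr0 => ->.
  by rewrite mulfK.
by apply: (@cvg_comp _ _ _ h g _ _ _ ch); exact: cg.
Qed.

(** Dilating the points [p], [q] by [t] multiplies [x], [y] by [t] and the
symplectic phase [s] by [t^2]. *)
Lemma cvg_theta (s x y : R) (t := fun k : nat => k.+1%:R^-1 : R) :
  (fun k => theta (s * t k ^+ 2) (x * t k) (y * t k) / t k ^+ 2) @ \oo -->
  x ^+ 2 + y ^+ 2 + 2 * s.
Proof.
have t0 k : t k != 0 by rewrite invr_eq0 pnatr_eq0.
have ct : t @ \oo --> 0 by exact: cvg_harmonic.
have cX (v : nat -> R) (l : R) : v @ \oo --> l -> (fun k => v k ^+ 2) @ \oo --> l ^+ 2.
  move=> cv; apply: (@cvg_comp _ _ _ v (fun y => y ^+ 2) _ _ _ cv).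
  exact: exprn_continuous.
have t20 k : t k ^+ 2 != 0 by rewrite expf_neq0.
have ct2 : (fun k => t k ^+ 2) @ \oo --> 0.
  by have := cX _ _ ct; rewrite expr0n.
have cs c := @cvg_sinV t c t0 ct; have cs2 c := @cvg_sinV (fun k => t k ^+ 2) c t20 ct2.
have csin c : (fun k => sin (c * t k)) @ \oo --> 0.
  rewrite -sin0; apply: (@cvg_comp _ _ _ _ sin); last exact: continuous_sin.
  by rewrite -(mulr0 c); apply: cvgM => //; exact: cvg_cst.
have ccos c : (fun k => cos (c * t k)) @ \oo --> (1 : R).
  rewrite -cos0; apply: (@cvg_comp _ _ _ _ cos); last exact: continuous_cos.
  by rewrite -(mulr0 c); apply: cvgM => //; exact: cvg_cst.
pose A c k := sin (c / 2 * t k) / t k.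
have cA c : A c @ \oo --> c / 2 by exact: cs.
pose u k := 4 * A x k ^+ 2 + 4 * A y k ^+ 2 +
  2 * (sin (s * t k ^+ 2) / t k ^+ 2 * cos ((x - y) * t k)
       - 2 * (sin (s / 2 * t k ^+ 2) / t k ^+ 2 * t k) ^+ 2 * sin ((x - y) * t k)
       - 2 * A y k ^+ 2 * sin (x * t k) + 2 * A x k ^+ 2 * sin (y * t k)).
have -> : (fun k => theta (s * t k ^+ 2) (x * t k) (y * t k) / t k ^+ 2) = u.
  apply/funext => k; rewrite thetaE /u /A mulrBl.
  rewrite (mulrAC x) (mulrAC y) (mulrAC s).
  by field; exact: t0.
have -> : x ^+ 2 + y ^+ 2 + 2 * s = 4 * (x / 2) ^+ 2 + 4 * (y / 2) ^+ 2 +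
  2 * (s * 1 - 2 * (s / 2 * 0) ^+ 2 * 0 - 2 * (y / 2) ^+ 2 * 0 + 2 * (x / 2) ^+ 2 * 0).
  by field.
have cc (v : nat -> R) (l c : R) : v @ \oo --> l -> (fun k => c * v k) @ \oo --> c * l.
  by move=> cv; apply: cvgM => //; exact: cvg_cst.
apply: cvgD.
  by apply: cvgD; apply: (cc); apply: cX; exact: cA.
apply: (cc); apply: cvgD; last by apply: cvgM => //; apply: (cc); apply: cX; exact: cA.
apply: cvgB; last by apply: cvgM => //; apply: (cc); apply: cX; exact: cA.
apply: cvgB; first by apply: cvgM.
by apply: cvgM => //; apply: (cc); apply: cX; apply: cvgM.
Qed.

End trig.

(** * The covariance matrix *)

Local Open Scope sesquilinear_scope.

Lemma integral_L2norm (R : realType) n (f : 'cV[R]_n -> R[i]) : L2norm f = 1%E ->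
  (\int[lebesgue_cV n]_x (Normc.normc (f x) ^+ 2)%:E = 1)%E.
Proof.
move=> f1; have := @poweR_Lnorm _ _ R (lebesgue_cV n) (fun x => (Normc.normc (f x))%:E) 2.
rewrite -/(L2norm f) f1 poweR1r => /(_ (lt0r_neq0 (ltr0n _ 2))) ->.
apply: eq_integral => x _.
by rewrite abse_EFin poweR_EFin ger0_norm ?normc_ge0// powR_mulrn// normc_ge0.
Qed.

Section covariance.
Context {R : realType} {n : nat}.
Variable f : 'cV[R]_n -> R[i].
Hypothesis mf : Cmeasurable f.
Local Notation mu := (@lebesgue_cV R n).
Local Notation mu2 := (@lebesgue_cV R (n + n)).
Hypothesis f1 : (\int[mu]_x (Normc.normc (f x) ^+ 2)%:E = 1)%E.
Implicit Types p q z : 'cV[R]_(n + n).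

(** Conjugation amounts to exchanging [y] and [- y] in the defining integral. *)
Lemma Wigner_real z : complex.Im (Wigner f z) = 0.
Proof.
set x := usubmx z; set xi := dsubmx z.
have iF : Cintegrable mu (fun y => lag f x y * expi (- (2 * pi * dotv xi y))).
  apply: Cintegrable_bounded; first exact: Cintegrable_lag_y.
    apply: Cmeasurable_expi; apply: measurableT_comp => //; apply: measurable_funM => //.
    rewrite (_ : dotv xi = fun y => dotv y xi); first exact: measurable_dotv.
    by apply/funext => y; rewrite dotvC.
  by move=> y; rewrite normc_expi.
have E : (wigner f x xi)^* = wigner f x xi.
  rewrite wignerE -Cintegral_conj//.
  have m1 : (-1 : R) != 0 by rewrite oppr_eq0 oner_eq0.
  have := transport_Cintegral (transport_affine 0 m1) iF.
  rewrite normrN1 expr1n invr1 mul1r => <-; apply: eq_Cintegral => y.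
  rewrite add0r scaleN1r dotvNr mulrN opprK.
  rewrite [LHS](rmorphM (@Num.conj R[i])) /= conj_expi opprK; congr (_ * _).
  by rewrite /lag rmorphM/= conjCK scalerN opprK mulrC.
have : complex.Im ((wigner f x xi)^*) = complex.Im (wigner f x xi) by rewrite E.
rewrite Im_conjc /Wigner -/x -/xi; lra.
Qed.

Hypothesis hW : (\int[mu2]_z ((1 + dotv z z) * Normc.normc (Wigner f z))%:E < +oo)%E.

Definition wig z : R := complex.Re (Wigner f z).

Lemma Wigner_wig z : Wigner f z = (wig z)%:C.
Proof. by apply: complex_ext; rewrite ?Wigner_real. Qed.

Lemma measurable_wig : measurable_fun setT wig.
Proof. exact: (Cmeasurable_Wigner mf).1. Qed.

Lemma normc_Wigner z : Normc.normc (Wigner f z) = `|wig z|.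
Proof. by rewrite Wigner_wig normc_real. Qed.

Lemma measurable_dotvv : measurable_fun setT (fun z : 'cV[R]_(n + n) => dotv z z).
Proof.
apply: measurable_sum => i; apply: measurable_funM; exact: measurable_entry.
Qed.

Lemma integrable_moment : mu2.-integrable setT (EFin \o (fun z => (1 + dotv z z) * `|wig z|)).
Proof.
apply/integrableP; split.
  apply/measurable_EFinP; apply: measurable_funM.
    by apply: measurable_funD => //; exact: measurable_dotvv.
  by apply: measurableT_comp => //; exact: measurable_wig.
under eq_integral => z _.
  rewrite /= ger0_norm; last by rewrite mulr_ge0// addr_ge0// dotv_ge0.
  rewrite -normc_Wigner.
  over.
exact: hW.
Qed.

Lemma integrable_wigM (g : 'cV[R]_(n + n) -> R) (c : R) : measurable_fun setT g ->
  (forall z, `|g z| <= c * (1 + dotv z z)) ->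
  mu2.-integrable setT (EFin \o (fun z => wig z * g z)).
Proof.
move=> mg gc; have := integrableZl measurableT c integrable_moment.
move=> /(le_integrable measurableT); apply.
  by apply/measurable_EFinP; apply: measurable_funM => //; exact: measurable_wig.
move=> z _; rewrite [leRHS](_ : _ = `|c * ((1 + dotv z z) * `|wig z|)|%:E)// lee_fin normrM mulrA mulrC.
apply: le_trans (ler_norm _); exact: ler_wpM2r.
Qed.

Lemma Cintegrable_Wigner : Cintegrable mu2 (Wigner f).
Proof.
apply: (Cintegrable_le (Cmeasurable_Wigner mf) integrable_moment) => z.
by rewrite normc_Wigner ler_peMl// lerDl dotv_ge0.
Qed.

(** Fourier inversion at the origin. *)
Lemma integral_wig : \int[mu2]_z wig z = 1.
Proof.
have := wigner_inversion mf f1 0 0 Cintegrable_Wigner.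
under eq_Cintegral do rewrite !dotv0r mulr0 expi0 !mulr1.
rewrite /corr; under [in RHS]eq_Cintegral do rewrite dotv0r mulr0 expi0 mul1r.
move=> /(congr1 (@complex.Re R)) /= ->.
rewrite /Rintegral -[RHS]/(fine 1%:E) -f1; congr fine.
apply: eq_integral => x _; rewrite /lag scaler0 subr0 addr0.
by rewrite ReM normc_sqr Re_conjc Im_conjc mulrN opprK !expr2.
Qed.

(** The coefficients [-(1 + i)], [1], [i] sum to zero, so the superposition of the
translates of [f] by [0], [p], [q] is a first difference: it is the discrete
version of the operator attached to [p + i q], applied to [f]. *)
Lemma integral_theta_ge0 p q :
  0 <= \int[mu2]_z (wig z * theta (pi * sigma p q) (2 * pi * dotv z p) (2 * pi * dotv z q)).
Proof.
have := quantum_bochner mf f1 [:: (- (1 +i* 1), 0); (1, p); (0 +i* 1, q)] Cintegrable_Wigner.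
suff <- : \int[mu2]_z (wig z * theta (pi * sigma p q) (2 * pi * dotv z p) (2 * pi * dotv z q)) =
    complex.Re (Cintegral mu2 (fun z => Wigner f z *
      \sum_(j <- [:: (- (1 +i* 1), 0); (1, p); (0 +i* 1, q)])
      \sum_(k <- [:: (- (1 +i* 1), 0); (1, p); (0 +i* 1, q)]) j.1 * k.1^* *
        expi (pi * sigma j.2 k.2 + 2 * pi * dotv z (j.2 - k.2)))) by [].
apply: eq_Rintegral => z _; rewrite Wigner_wig ReM mul0r subr0; congr (_ * _).
have s0r (r : 'cV[R]_(n + n)) : sigma r 0 = 0.
  by rewrite /sigma !linear0 (dotvC 0) !dotv0r subrr.
have s0l (r : 'cV[R]_(n + n)) : sigma 0 r = 0.
  by rewrite /sigma !linear0 (dotvC 0) !dotv0r subrr.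
have sx (r : 'cV[R]_(n + n)) : sigma r r = 0 by rewrite /sigma subrr.
have sA : sigma q p = - sigma p q by rewrite /sigma opprB.
rewrite !big_cons !big_nil /= !subr0 !sub0r !subrr !s0r !s0l !sx sA !dotvDr !dotvNr !dotv0r.
rewrite !(mulr0, addr0, add0r, mulrN, cosN, sinN).
rewrite (cosD (pi * _)) (sinD (pi * _)) (cosD (- _)) (sinD (- _)) !(cosN, sinN).
rewrite /theta cos0 sin0 -(addrA (pi * _)) (sinD (pi * _)) !(mulrBr (2 * pi)) !cosB !sinB; ring.
Qed.

Lemma dotv_sqr_le z p : dotv z p ^+ 2 <= dotv p p * (1 + dotv z z).
Proof.
rewrite (le_trans (dotv_CS z p))// mulrC ler_wpM2l ?dotv_ge0//.
by rewrite lerDr.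
Qed.

Lemma sigmaZ (t : R) p q : sigma (t *: p) (t *: q) = t ^+ 2 * sigma p q.
Proof.
by rewrite /sigma !linearZ/= !dotvZl !dotvZr expr2 mulrBr !mulrA.
Qed.

(** The second-order term of [integral_theta_ge0] at the origin, along the points
[t p] and [t q]. *)
Lemma uncertainty_ge0 p q :
  0 <= 4 * pi ^+ 2 * (\int[mu2]_z (wig z * dotv z p ^+ 2) +
                       \int[mu2]_z (wig z * dotv z q ^+ 2)) + 2 * pi * sigma p q.
Proof.
pose t (k : nat) : R := k.+1%:R^-1.
have t0 k : 0 < t k by rewrite invr_gt0.
pose g k z := theta (pi * sigma p q * t k ^+ 2) (2 * pi * dotv z p * t k)
  (2 * pi * dotv z q * t k) / t k ^+ 2.
pose G z := (2 * pi * dotv z p) ^+ 2 + (2 * pi * dotv z q) ^+ 2 + 2 * (pi * sigma p q).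
(* The constant that [theta_le] and Cauchy-Schwarz produce. *)
pose c := 8 * pi ^+ 2 * (dotv p p + dotv q q) + 4 * `|pi * sigma p q|.
have gc k z : `|g k z| <= c * (1 + dotv z z).
  rewrite normrM normfV (ger0_norm (exprn_ge0 2 (ltW (t0 k)))) ler_pdivrMr ?exprn_gt0//.
  rewrite (le_trans (theta_le _ _ _))// normrM (ger0_norm (exprn_ge0 2 (ltW (t0 k)))).
  rewrite !exprMn.
  rewrite (_ : _ + _ = (8 * pi ^+ 2 * (dotv z p ^+ 2 + dotv z q ^+ 2) +
    4 * `|pi * sigma p q|) * t k ^+ 2); last by ring.
  rewrite ler_pM2r ?exprn_gt0// /c.
  have h1 := dotv_sqr_le z p; have h2 := dotv_sqr_le z q.
  have h3 := pi_ge0 R; have h4 := dotv_ge0 z; have h5 := normr_ge0 (pi * sigma p q).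
  rewrite [leRHS]mulrDl lerD//; last by rewrite ler_peMr ?mulr_ge0// lerDl.
  by rewrite -[leRHS]mulrA ler_wpM2l ?mulr_ge0 ?sqr_ge0// [leRHS]mulrDl lerD.
have mG' p' : measurable_fun setT (fun z : 'cV[R]_(n + n) => 2 * pi * dotv z p').
  by apply: measurable_funM => //; exact: measurable_dotv.
have mg k : measurable_fun setT (g k).
  have mt p' : measurable_fun setT (fun z : 'cV[R]_(n + n) => 2 * pi * dotv z p' * t k).
    exact: measurable_funM.
  have mc (h : 'cV[R]_(n + n) -> R) : measurable_fun setT h -> measurable_fun setT (fun z => cos (h z)).
    by move=> mh; apply: measurableT_comp => //; apply: continuous_measurable_fun; exact: continuous_cos.
  have ms (h : 'cV[R]_(n + n) -> R) : measurable_fun setT h -> measurable_fun setT (fun z => sin (h z)).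
    by move=> mh; apply: measurableT_comp => //; apply: continuous_measurable_fun; exact: continuous_sin.
  apply: measurable_funM => //; rewrite /theta.
  apply: measurable_funD; last first.
    apply: measurable_funM => //; apply: ms; apply: measurable_funB => //.
    exact: measurable_funD.
  apply: measurable_funD; last by apply: measurable_funM => //; exact: ms.
  apply: measurable_funB; last by apply: measurable_funM => //; exact: mc.
  apply: measurable_funB; last by apply: measurable_funM => //; exact: ms.
  apply: measurable_funB => //; by apply: measurable_funM => //; exact: mc.
have mG : measurable_fun setT G.
  by apply: measurable_funD => //; apply: measurable_funD; apply: measurable_funX.
have L : \int[mu2]_z (wig z * g k z) @[k --> \oo] --> \int[mu2]_z (wig z * G z).
  apply: (@Rintegral_dct _ _ _ _ _ _ (fun z => c * ((1 + dotv z z) * `|wig z|))).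
  - by move=> k; apply: measurable_funM => //; exact: measurable_wig.
  - by apply: measurable_funM => //; exact: measurable_wig.
  - by move=> z; apply: cvgM; [exact: cvg_cst|exact: cvg_theta].
  - exact: (integrableZl measurableT c integrable_moment).
  - by move=> k z; rewrite normrM mulrC mulrA ler_wpM2r.
have pos : 0 <= \int[mu2]_z (wig z * G z).
  apply: (cvgr_to_ge L); near=> k.
  rewrite -(pmulr_rge0 _ (exprn_gt0 2 (t0 k))) -RintegralZl//; last first.
    exact: (integrable_wigM (mg k) (gc k)).
  rewrite (_ : \int[mu2]_z _ = \int[mu2]_z (wig z *
    theta (pi * sigma (t k *: p) (t k *: q)) (2 * pi * dotv z (t k *: p))
      (2 * pi * dotv z (t k *: q)))); first exact: integral_theta_ge0.
  apply: eq_Rintegral => z _; rewrite /g sigmaZ !dotvZr mulrCA; congr (_ * _).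
  rewrite mulrC divfK ?gt_eqF ?exprn_gt0//; congr theta; by ring.
have iG p' : mu2.-integrable setT (EFin \o (fun z => wig z * dotv z p' ^+ 2)).
  apply: (@integrable_wigM _ (dotv p' p')).
    by apply: measurable_funX; exact: measurable_dotv.
  by move=> z; rewrite ger0_norm ?sqr_ge0// dotv_sqr_le.
have iW : mu2.-integrable setT (EFin \o wig) by exact: Cintegrable_Wigner.1.
have E : \int[mu2]_z (wig z * G z) = 4 * pi ^+ 2 *
    (\int[mu2]_z (wig z * dotv z p ^+ 2) + \int[mu2]_z (wig z * dotv z q ^+ 2)) +
    2 * pi * sigma p q.
  rewrite -RintegralD//.
  have iS : mu2.-integrable setT (EFin \o (fun z => wig z * dotv z p ^+ 2 + wig z * dotv z q ^+ 2)).
    have := integrableD measurableT (iG p) (iG q).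
    by apply: eq_integrable => // z _; rewrite /= EFinD.
  have -> : 2 * pi * sigma p q = \int[mu2]_z (2 * pi * sigma p q * wig z).
    by rewrite RintegralZl// integral_wig mulr1.
  rewrite -RintegralZl// -RintegralD//; first by apply: eq_Rintegral => z _; rewrite /G; ring.
    exact: (integrableZl measurableT (4 * pi ^+ 2) iS).
  exact: (integrableZl measurableT (2 * pi * sigma p q) iW).
by rewrite -E.
Unshelve. all: end_near.
Qed.

Definition moment_mx : 'M[R]_(n + n) :=
  \matrix_(a, b) \int[mu2]_z (wig z * (z a ord0 * z b ord0)).

Lemma wigner_covE : wigner_cov f = map_mx (real_complex R) moment_mx.
Proof.
apply/matrixP => a b; rewrite !mxE; under eq_Cintegral do rewrite Wigner_wig.
apply: complex_ext => /=; first by apply: eq_Rintegral => z _; ring.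
under eq_Rintegral do rewrite mulr0 mul0r addr0.
by rewrite /Rintegral integral0.
Qed.

Lemma normr_entryM_le z a b : `|z a ord0 * z b ord0| <= 1 * (1 + dotv z z).
Proof.
have E c : z c ord0 ^+ 2 <= dotv z z.
  rewrite /dotv (bigD1 c)//= expr2 lerDl sumr_ge0// => i _.
  by rewrite -expr2 sqr_ge0.
have := E a; have := E b; have := dotv_ge0 z.
rewrite mul1r ler_norml; have := sqr_ge0 (z a ord0 + z b ord0).
have := sqr_ge0 (z a ord0 - z b ord0); rewrite !expr2; lra.
Qed.

Lemma moment_mxT : moment_mx^T = moment_mx.
Proof.
apply/matrixP => a b.
by rewrite !mxE; apply: eq_Rintegral => z _; rewrite (mulrC (z a ord0)).
Qed.

Lemma moment_form p : (p^T *m moment_mx *m p) ord0 ord0 =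
  \int[mu2]_z (wig z * dotv z p ^+ 2).
Proof.
have iz a b : mu2.-integrable setT (EFin \o (fun z => wig z * (z a ord0 * z b ord0))).
  apply: (integrable_wigM (c := 1)); last by move=> z; exact: normr_entryM_le.
  by apply: measurable_funM; exact: measurable_entry.
have E z : wig z * dotv z p ^+ 2 =
    \sum_b \sum_a p a ord0 * p b ord0 * (wig z * (z a ord0 * z b ord0)).
  rewrite expr2 /dotv big_distrlr/= mulr_sumr exchange_big/=; apply: eq_bigr => b _.
  by rewrite mulr_sumr; apply: eq_bigr => a _; ring.
under [RHS]eq_Rintegral do rewrite E.
have izp a b : mu2.-integrable setT (EFin \o
    (fun z => p a ord0 * p b ord0 * (wig z * (z a ord0 * z b ord0)))).
  exact: (integrableZl measurableT (p a ord0 * p b ord0) (iz a b)).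
rewrite Rintegral_sum; last first.
  move=> b; have := @integrable_sum _ _ _ mu2 setT measurableT _ _ xpredT _ (fun a _ => izp a b).
  by move=> /(_ (index_enum _)); apply: eq_integrable => // t _; rewrite /= -sumEFin.
rewrite mxE; apply: eq_bigr => b _; rewrite Rintegral_sum// mxE mulr_suml.
apply: eq_bigr => a _; rewrite !mxE RintegralZl//; ring.
Qed.

End covariance.

Lemma symplJ_form (R : realType) n (p q : 'cV[R]_(n + n)) :
  (p^T *m symplJ *m q) ord0 ord0 = - sigma p q.
Proof.
rewrite -{1}(vsubmxK p) -{1}(vsubmxK q) tr_col_mx /symplJ mul_row_block.
rewrite !mulmx0 add0r addr0 mulmxN !mulmx1 mul_row_col mulNmx !mxE.
rewrite /sigma /dotv opprB addrC; congr (_ + _).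
  by apply: eq_bigr => i _; rewrite !mxE mulrC.
by congr (- _); apply: eq_bigr => i _; rewrite !mxE.
Qed.

(** The real part of the form only depends on the symmetric part of [A], and its
imaginary part on the antisymmetric part. *)
Lemma real_form (R : realType) m (A : 'M[R]_m) (w : 'cV[R[i]]_m)
    (p := map_mx (@complex.Re R) w) (q := map_mx (@complex.Im R) w) :
  (w ^t* *m map_mx (real_complex R) A *m w) ord0 ord0 =
  ((p^T *m A *m p) ord0 ord0 + (q^T *m A *m q) ord0 ord0) +i*
  ((p^T *m A *m q) ord0 ord0 - (q^T *m A *m p) ord0 ord0).
Proof.
have F (u v : 'cV[R]_m) : (u^T *m A *m v) ord0 ord0 =
    \sum_b \sum_a u a ord0 * A a b * v b ord0.
  by rewrite mxE; apply: eq_bigr => b _; rewrite mxE mulr_suml; apply: eq_bigr => a _; rewrite mxE.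
have -> : (w ^t* *m map_mx (real_complex R) A *m w) ord0 ord0 =
    \sum_b \sum_a (w a ord0)^* * (A a b)%:C * w b ord0.
  by rewrite mxE; apply: eq_bigr => b _; rewrite mxE mulr_suml; apply: eq_bigr => a _; rewrite !mxE.
rewrite !F -!big_split/= -sumrB.
have ReS I (r : seq I) (h : I -> R[i]) : complex.Re (\sum_(i <- r) h i) = \sum_(i <- r) complex.Re (h i).
  exact: (big_morph _ (@ReD R)).
have ImS I (r : seq I) (h : I -> R[i]) : complex.Im (\sum_(i <- r) h i) = \sum_(i <- r) complex.Im (h i).
  exact: (big_morph _ (@ImD R)).
apply: complex_ext => /=.
  rewrite ReS; apply: eq_bigr => b _; rewrite ReS -big_split/=; apply: eq_bigr => a _.
  by rewrite !mxE; case: (w a ord0) (w b ord0) => [x y] [x' y'] /=; ring.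
rewrite ImS; apply: eq_bigr => b _; rewrite ImS -sumrB; apply: eq_bigr => a _.
by rewrite !mxE; case: (w a ord0) (w b ord0) => [x y] [x' y'] /=; ring.
Qed.

Lemma tr_form (R : realType) m (A : 'M[R]_m) (p q : 'cV[R]_m) :
  (p^T *m A *m q) ord0 ord0 = (q^T *m A^T *m p) ord0 ord0.
Proof. by rewrite -[in RHS](trmxK p) -!trmx_mul mulmxA [RHS]mxE. Qed.

Lemma symplJT (R : realType) n : (@symplJ R n)^T = - symplJ.
Proof. by rewrite /symplJ tr_block_mx !linear0 linearN/= !trmx1 opp_block_mx !oppr0 opprK. Qed.

Lemma psdmx_congr (R : realType) m (D : 'M[R]_m) (H : 'M[R[i]]_m) : psdmx H ->
  psdmx (map_mx (real_complex R) D *m H *m (map_mx (real_complex R) D)^T).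
Proof.
set DC := map_mx _ D => -[/is_hermitianmxP hH pH].
have E : DC ^t* = DC^T by apply/matrixP => i j; rewrite !mxE /= [LHS]conjc_real.
have ET : DC^T ^t* = DC by apply/matrixP => i j; rewrite !mxE /= [LHS]conjc_real.
rewrite expr0 scale1r in hH.
split.
  apply/is_hermitianmxP; rewrite expr0 scale1r.
  by rewrite !trmx_mul !map_mxM ET E -hH mulmxA.
move=> v; have := pH (DC^T *m v).
by rewrite trmx_mul map_mxM ET !mulmxA.
Qed.

Lemma i_div_4pi (R : realType) : ('i / (4 * pi)%:C : R[i]) = 0 +i* (4 * pi)^-1.
Proof.
rewrite -complexiE -[X in _ * X^-1]/(real_complex R (4 * pi)) -fmorphV.
rewrite -[X in _ * X]/((4 * pi)^-1)%:C.
by apply: complex_ext; rewrite /=; ring.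
Qed.

Lemma hermsymmx_real (R : realType) m (M A : 'M[R]_m) (c : R) : M^T = M -> A^T = - A ->
  map_mx (real_complex R) M + (0 +i* c) *: map_mx (real_complex R) A \is hermsymmx.
Proof.
move=> MT AT; apply/is_hermitianmxP; rewrite expr0 scale1r; apply/matrixP => a b.
have Mab : M b a = M a b by rewrite -[in LHS]MT mxE.
have Aab : A b a = - A a b by rewrite -[in LHS](trmxK A) AT !mxE.
rewrite !mxE Mab Aab; apply: complex_ext => /=; ring.
Qed.

Section uncertainty.
Context {R : realType} {n : nat}.
Variable f : 'cV[R]_n -> R[i].
Hypothesis mf : Cmeasurable f.
Hypothesis f1 : (\int[lebesgue_cV n]_x (Normc.normc (f x) ^+ 2)%:E = 1)%E.
Hypothesis hW : (\int[lebesgue_cV (n + n)]_z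
  ((1 + dotv z z) * Normc.normc (Wigner f z))%:E < +oo)%E.

(** On the vector [p + i q] the form is the number of [uncertainty_ge0] divided by
[4 pi^2]. *)
Lemma robertson_schrodinger :
  psdmx (wigner_cov f + ('i / (4 * pi)%:C) *: map_mx (real_complex R) symplJ).
Proof.
rewrite (wigner_covE mf f1) i_div_4pi; split.
  exact: hermsymmx_real (moment_mxT f) (symplJT R n).
move=> w; rewrite mulmxDr mulmxDl -scalemxAr -scalemxAl mxE [X in _ + X]mxE !real_form.
rewrite !(moment_form mf f1 hW) !symplJ_form.
set p := map_mx _ _; set q := map_mx _ _.
have U := uncertainty_ge0 mf f1 hW p q.
have pi0 := pi_gt0 R.
have sA : sigma q p = - sigma p q by rewrite /sigma opprB.
rewrite (tr_form _ q) moment_mxT sA lecE/=; apply/andP; split.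
  by apply/eqP; rewrite /sigma; ring.
set X := (\int[_]_z _ + _) in U *; move: (pi : R) pi0 U => c c0 U.
have -> : X + (0 * (- sigma p p - sigma q q) - (4 * c)^-1 * (- sigma p q - - - sigma p q)) =
    (4 * c ^+ 2 * X + 2 * c * sigma p q) / (4 * c ^+ 2).
  by field; exact: lt0r_neq0.
by rewrite divr_ge0// mulr_ge0// sqr_ge0.
Qed.

End uncertainty.

Theorem theorem7 (R : realType) (n : nat) (S1 S2 : 'M[R]_(n + n))
    (A1 B1 C1 D1 A2 B2 C2 D2 : 'M[R]_n) (f : 'cV[R]_n -> R[i])
    (hS1 : symplectic S1) (hS2 : symplectic S2)
    (hb1 : S1 = block_mx A1 B1 C1 D1) (hb2 : S2 = block_mx A2 B2 C2 D2)
    (hf : L2 f) (hf1 : L2norm f = 1%E)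
    (hW : (\int[lebesgue_cV (n + n)]_z
             ((1 + dotv z z) * Normc.normc (Wigner f z))%:E < +oo)%E)
    (hmean : forall a : 'I_(n + n),
       Cintegral (lebesgue_cV (n + n))
         (fun z => (z a ord0)%:C * Wigner f z) = 0) :
  let D12 : 'M[R]_(n + n) := block_mx A1 B1 A2 B2 in
  let Omega := D12 *m symplJ *m D12^T in
  let Sigma := wigner_cov f in
  let D12C := map_mx (real_complex R) D12 in
  let Upsilon := D12C *m Sigma *m D12C^T in
  psdmx (Upsilon + ('i / (4 * pi)%:C) *: map_mx (real_complex R) Omega).
Proof.
move=> D12 Omega Sigma D12C Upsilon.
have [mRe mIm _] := hf.
have P := psdmx_congr D12 (robertson_schrodinger (conj mRe mIm) (integral_L2norm hf1) hW).
rewrite mulmxDr mulmxDl -scalemxAr -scalemxAl in P.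
by rewrite /Omega !map_mxM -map_trmx.
Qed.
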